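(* For any two Borel probability measures $\mu,\nu$ on $[-2,2]$, $$W_1^2(\mu,\nu)\le 2\,\mathcal{H}(\mu,\nu).$$ Equality is attained for any two probability measures $\mu,\nu$ on $[-2,2]$ such that $\mu(dx)-\nu(dx)=c\,x\,\beta(dx)$ for some constant $c$.
   Context: $W_1$ is the Wasserstein distance $W_1(\mu,\nu)=\inf_{\pi\in\Pi(\mu,\nu)}\int|x-y|\,\pi(dx\,dy)$, where $\Pi(\mu,\nu)$ is the set of probability measures on $\mathbb{R}^2$ with marginals $\mu,\nu$. The free reduced relative entropy of two compactly supported probability measures is $$\mathcal{H}(\mu,\nu)=-\iint\log|x-y|\,(\mu-\nu)(dx)(\mu-\nu)(dy)$$ if $\iint|\log|x-y||\,\mu(dx)\mu(dy)<\infty$ and $\iint|\log|x-y||\,\nu(dx)\nu(dy)<\infty$, and $\mathcal{H}(\mu,\nu)=+\infty$ if either of these conditions fails. The measure $\beta$ is the arcsine law on $[-2,2]$: $\beta(dx)=\frac{dx}{\pi\sqrt{4-x^2}}$.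
   Formalization: The equality clause additionally assumes H(μ,ν) < +∞; without it the claim fails, e.g. for c = 0 and μ = ν = δ_0, where W_1 = 0 but H = +∞. *)

(* Defs.v *)
From HB Require Import structures.
From mathcomp Require Import all_boot all_order all_algebra.
From mathcomp Require Import all_classical all_reals all_analysis.
From mathcomp Require Import measurable_realfun.

Set Implicit Arguments.
Unset Strict Implicit.
Unset Printing Implicit Defensive.

Import Order.TTheory GRing.Theory Num.Theory.
Import numFieldNormedType.Exports.

Local Open Scope classical_set_scope.
Local Open Scope ring_scope.
Local Open Scope ereal_scope.

Notation borel_probability R := (probability (measurableTypeR R) R).

Notation borel_probability2 R :=
  (probability (measurableTypeR R * measurableTypeR R)%type R).

Definition supported_m22 (R : realType) (mu : borel_probability R) : Prop :=
  mu `[(- 2)%R, 2%R]%classic = 1.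

Definition coupling (R : realType) (mu nu : borel_probability R) :
    set (borel_probability2 R) :=
  [set p | forall A : set (measurableTypeR R), measurable A ->
    pushforward p fst A = mu A /\ pushforward p snd A = nu A].

Definition W1 (R : realType) (mu nu : borel_probability R) : \bar R :=
  ereal_inf [set \int[p]_z `|z.1 - z.2|%:E | p in coupling mu nu].

(* [lne] is the extended logarithm: the kernel is -oo on the diagonal, so that
   a measure with an atom has infinite logarithmic energy.  The real-valued
   [ln] has [ln 0 = 0] and would not see atoms. *)
Definition log_dist (R : realType)
    (z : measurableTypeR R * measurableTypeR R) : \bar R :=
  lne `|z.1 - z.2|%:E.

Definition finite_log_energy (R : realType) (mu : borel_probability R) : Prop :=
  \int[mu \x mu]_z `|log_dist z| < +oo.

(* The double integral of [f] against (mu - nu)(dx) (mu - nu)(dy), expanded by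
   bilinearity.  It is only used when both logarithmic energies are finite; all
   four terms are then finite for compactly supported measures and no
   indeterminate difference of infinities occurs. *)
Definition signed_double_integral (R : realType) (mu nu : borel_probability R)
    (f : measurableTypeR R * measurableTypeR R -> \bar R) : \bar R :=
  \int[mu \x mu]_z f z - \int[mu \x nu]_z f z
  - \int[nu \x mu]_z f z + \int[nu \x nu]_z f z.

Definition free_entropy (R : realType) (mu nu : borel_probability R) : \bar R :=
  if `[< finite_log_energy mu /\ finite_log_energy nu >]
  then - signed_double_integral mu nu (@log_dist R)
  else +oo.

(* At [x = 2] and [x = -2] this is 0, which does not affect the law below. *)
Definition arcsine_density (R : realType) (x : R) : R :=
  (pi * Num.sqrt (4 - x ^+ 2))^-1%R.

Lemma arcsine_density_ge0 (R : realType) (x : R) : (0 <= arcsine_density x)%R.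
Proof. by rewrite invr_ge0 mulr_ge0 ?pi_ge0 ?sqrtr_ge0. Qed.

Lemma measurable_arcsine_density (R : realType) :
  measurable_fun [set: measurableTypeR R] (@arcsine_density R).
Proof.
have -> : @arcsine_density R =
    (fun x => ((pi * Num.sqrt (4 - x ^+ 2)) `^ (-1))%R).
  by apply/funext => x; rewrite powR_inv1// mulr_ge0 ?pi_ge0 ?sqrtr_ge0.
apply: (@measurableT_comp _ _ _ _ _ _ (fun y : measurableTypeR R => (y `^ (-1))%R)
  _ (fun x : measurableTypeR R => (pi * Num.sqrt (4 - x ^+ 2))%R)).
  exact: measurable_powR.
apply: continuous_measurable_fun => x; apply: cvgM; first exact: cvg_cst.
apply: (@continuous_comp _ _ _ (fun y : R => (4 - y ^+ 2)%R) Num.sqrt).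
  by apply: cvgB; [exact: cvg_cst|exact: exprn_continuous].
exact: sqrt_continuous.
Qed.

Definition arcsine_law (R : realType) (A : set (measurableTypeR R)) : \bar R :=
  \int[lebesgue_measure]_(x in A `&` `[(- 2)%R, 2%R]%classic) (arcsine_density x)%:E.

Section arcsine_law_measure.
Context {R : realType}.

Let arcsine0 : arcsine_law (set0 : set (measurableTypeR R)) = 0.
Proof. by rewrite /arcsine_law set0I integral_set0. Qed.

Let arcsine_ge0 (A : set (measurableTypeR R)) : 0 <= arcsine_law A.
Proof.
by apply: integral_ge0 => x _; rewrite lee_fin arcsine_density_ge0.
Qed.

Let arcsine_sigma_additive : semi_sigma_additive (@arcsine_law R).
Proof.
move=> F mF tF mUF; rewrite /arcsine_law setI_bigcupl; apply: cvg_toP.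
  apply: ereal_nondecreasing_is_cvgn => m n mn.
  by apply: lee_sum_nneg_natr => // k _ _; exact: arcsine_ge0.
rewrite ge0_integral_bigcup//=.
- by move=> k; exact: measurableI.
- apply: measurable_funTS; apply: measurableT_comp => //.
  exact: measurable_arcsine_density.
- by move=> x _; rewrite lee_fin arcsine_density_ge0.
- exact: trivIset_setIr.
Qed.

HB.instance Definition _ := isMeasure.Build _ _ _ (@arcsine_law R)
  arcsine0 arcsine_ge0 arcsine_sigma_additive.

End arcsine_law_measure.

(* Main.v *)
From HB Require Import structures.
Require Import Defs.
From mathcomp Require Import all_boot all_order all_algebra.
From mathcomp Require Import all_classical all_reals all_analysis.
From mathcomp Require Import measurable_realfun.
From mathcomp Require Import ring lra.

(** Parametrise [-2, 2] by x = 2 cos a with 0 <= a <= pi, and put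
    sigma = mu - nu and a_n = int cos (n a) dsigma.

    The logarithm is diagonal in this coordinate:
      - log |x - y| = sum_(n >= 1) (2/n) cos (n a) cos (n b),
    so that H(mu, nu) = 2 sum_(n >= 1) a_n ^ 2 / n.  The kernel is singular, so
    the series is first inserted with weights r ^ n, r < 1, where it converges
    uniformly ([log_kernel_expansion], [sdouble_reg_kernel_cvg]); letting r
    tend to 1 recovers the entropy ([free_entropy_limit]).  Dominated
    convergence needs the mixed energy of mu and nu to be finite, which follows
    from Fatou's lemma and the positivity of the regularised form.

    Replacing 1/n by 1/n ^ 2 decreases the sum.  The resulting kernel
    sum_n (2/n ^ 2) cos (n a) cos (n b) is elementary: it equals
    - pi max(a, b) plus a function of a plus a function of b, and sigma has
    total mass 0.  With Phi(t) = sigma (a <= t) this gives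
      H(mu, nu) >= pi int_0^pi Phi(t) ^ 2 dt       ([entropy_ge_cdf_gap2]).
    The Fourier series of a quadratic polynomial used here is obtained from
    Fejer sums ([fejer_sum_cvg]); their weights lie in [0, 1], hence the finite
    sums are still dominated by the entropy.

    On the transport side, |2 cos a - 2 cos b| is the integral of 2 sin t over
    the t separating a and b, and the comonotone coupling of mu and nu makes
    the events {a <= t} and {b <= t} nested.  Hence
      W_1(mu, nu) <= int_0^pi |Phi(t)| 2 sin t dt  ([W1_le_cdf_gap])
    and Cauchy-Schwarz gives W_1 ^ 2 <= 2 pi int_0^pi Phi ^ 2 <= 2 H.

    If sigma = c x beta, then Phi is proportional to sin, because beta is the
    law of 2 cos t for uniform t ([arcsine_law_distribution],
    [cdf_gap_arcsine]).  Then a_n = 0 for n >= 2 by orthogonality of the sines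
    ([moment_arcsine]), so H = 2 a_1 ^ 2, while testing any coupling against
    the 1-Lipschitz function x gives W_1 >= 2 |a_1| ([W1_ge_moment]).

    All integrals over [0, pi] are taken against the normalised measure dt/pi,
    so that every measure is a probability and, apart from the logarithm, every
    integrand is a bounded measurable function. *)

Set Implicit Arguments.
Unset Strict Implicit.
Unset Printing Implicit Defensive.

Import Order.TTheory GRing.Theory Num.Theory.
Import numFieldNormedType.Exports.

Local Open Scope classical_set_scope.
Local Open Scope ring_scope.

(** * Derivatives of explicit functions *)

Section derivative_rules.
Context {R : realType}.
Implicit Types (f g : R -> R) (x a b k : R).

(** A plain proposition, unlike the class [is_derive]: instance search would
    replace the prescribed value of the derivative by a synthesised one. *)
Definition has_deriv f x a : Prop := is_derive x 1 f a.

Lemma deriv_eq f x a b : has_deriv f x a -> a = b -> has_deriv f x b.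
Proof. by move=> + <-. Qed.

Lemma deriv_cst x a : has_deriv (fun=> a) x 0.
Proof. exact: is_derive_cst. Qed.

Lemma deriv_id x : has_deriv (fun y => y) x 1.
Proof. exact: is_derive_id. Qed.

Lemma derivD f g x a b : has_deriv f x a -> has_deriv g x b ->
  has_deriv (fun y => f y + g y) x (a + b).
Proof. exact: is_deriveD. Qed.

Lemma derivB f g x a b : has_deriv f x a -> has_deriv g x b ->
  has_deriv (fun y => f y - g y) x (a - b).
Proof. exact: is_deriveB. Qed.

Lemma derivZ f x a k : has_deriv f x a -> has_deriv (fun y => k * f y) x (k * a).
Proof. exact: is_deriveZ. Qed.

Lemma deriv_comp f g x a b : has_deriv f (g x) a -> has_deriv g x b ->
  has_deriv (fun y => f (g y)) x (a * b).
Proof. exact: is_derive1_comp. Qed.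

Lemma deriv_exp n x : has_deriv (fun y => y ^+ n) x (n%:R * x ^+ n.-1).
Proof.
have H := @is_deriveX R R id n x 1 1 (is_derive_id _ _).
rewrite /has_deriv [X in is_derive _ _ X](_ : _ = (id : R -> R) ^+ n); last first.
  by apply/funext => y; rewrite exprfctE.
by apply: is_derive_eq; rewrite [_ *: _]mulr1.
Qed.

Lemma deriv_sum n (h dh : 'I_n -> R -> R) x :
  (forall i, has_deriv (h i) x (dh i x)) ->
  has_deriv (fun y => \sum_(i < n) h i y) x (\sum_(i < n) dh i x).
Proof.
move=> H; rewrite /has_deriv [X in is_derive _ _ X](_ : _ = \sum_(i < n) h i).
  exact: is_derive_sum.
by apply/funext => y; rewrite fct_sumE.
Qed.

Lemma deriv_cosM k x : has_deriv (fun y => cos (k * y)) x (- (k * sin (k * x))).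
Proof.
apply: (deriv_eq (a := - sin (k * x) * (k * 1))).
  exact (deriv_comp (is_derive_cos (k * x)) (derivZ k (deriv_id x))).
by rewrite mulr1 mulNr mulrC.
Qed.

Lemma deriv_sinM k x : has_deriv (fun y => sin (k * y)) x (k * cos (k * x)).
Proof.
apply: (deriv_eq (a := cos (k * x) * (k * 1))).
  exact (deriv_comp (is_derive_sin (k * x)) (derivZ k (deriv_id x))).
by rewrite mulr1 mulrC.
Qed.

Lemma has_deriv_continuous f (df : R -> R) :
  (forall x, has_deriv f x (df x)) -> continuous f.
Proof.
move=> Df x; apply/differentiable_continuous/derivable1_diffP.
by have [] := Df x.
Qed.

Lemma MVT_bound f df a b M : a <= b ->
  (forall x, a <= x <= b -> has_deriv f x (df x)) ->
  (forall x, a <= x <= b -> `|df x| <= M) ->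
  `|f b - f a| <= M * (b - a).
Proof.
move=> ab Df dfM.
have [||c] := @MVT_segment R f df a b ab.
- by move=> x; rewrite in_itv/= => /andP[ax xb]; apply: Df; rewrite !ltW.
- apply: continuous_in_subspaceT => x; rewrite inE/= in_itv/= => xab.
  apply/differentiable_continuous/derivable1_diffP.
  by have [] := Df x xab.
rewrite in_itv/= => cab ->.
by rewrite normrM (@ger0_norm _ (b - a)) ?subr_ge0// ler_wpM2r ?subr_ge0// dfM.
Qed.

End derivative_rules.

(** * The logarithmic kernel as a cosine series *)

Section log_kernel.
Context {R : realType}.
Implicit Types (r s t : R).

Lemma cos_rec n t : cos (n.+2%:R * t) + cos (n%:R * t) = 2 * cos t * cos (n.+1%:R * t) :> R.
Proof.
have -> : n%:R * t = n.+1%:R * t - t by rewrite -natr1; ring.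
have -> : n.+2%:R * t = n.+1%:R * t + t by rewrite -[n.+2%:R]natr1; ring.
rewrite cosD cosB; lra.
Qed.

(** The squared modulus of 1 - r exp (i t), the denominator of the Poisson
    kernel. *)
Definition poisson_den r t := 1 - 2 * r * cos t + r ^+ 2.

(** The real part of - log (1 - r exp (i t)). *)
Definition log_kernel r t := - ln (poisson_den r t) / 2.

Lemma poisson_den_ge r t : 0 <= r -> (1 - r) ^+ 2 <= poisson_den r t.
Proof. move=> r0; rewrite /poisson_den; have := cos_le1 t; nra. Qed.

Lemma poisson_den_gt0 r t : 0 <= r < 1 -> 0 < poisson_den r t.
Proof.
move=> /andP[r0 r1]; apply: lt_le_trans (poisson_den_ge t r0).
by rewrite exprn_gt0// subr_gt0.
Qed.

Lemma poisson_den_le4 r t : 0 <= r <= 1 -> poisson_den r t <= 4.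
Proof. move=> /andP[r0 r1]; rewrite /poisson_den; have := cos_geN1 t; nra. Qed.

(** The partial sums of Re (exp (i t) / (1 - s exp (i t))), with the exact
    remainder of the geometric series. *)
Lemma cos_geometric_sum n s t :
  cos t - s - poisson_den s t * (\sum_(i < n) s ^+ i * cos (i.+1%:R * t)) =
  s ^+ n * (cos (n.+1%:R * t) - s * cos (n%:R * t)).
Proof.
elim: n => [|n IHn]; first by rewrite big_ord0 !mul1r mul0r cos0; ring.
rewrite big_ord_recr/= mulrDr opprD addrA IHn /poisson_den (exprS s n).
have -> : cos (n.+2%:R * t) = 2 * cos t * cos (n.+1%:R * t) - cos (n%:R * t).
  by rewrite -cos_rec addrK.
ring.
Qed.

(** Both sides vanish at r = 0, and by [cos_geometric_sum] the derivative in r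
    of their difference is a geometric remainder of size r ^ n / (1 - r) ^ 2.
    The bound is uniform in t, which lets it be integrated against any measure. *)
Lemma log_kernel_expansion r t n : 0 <= r < 1 ->
  `|log_kernel r t - \sum_(i < n) r ^+ i.+1 / i.+1%:R * cos (i.+1%:R * t)|
    <= 2 * r ^+ n / (1 - r) ^+ 2.
Proof.
move=> /andP[r0 r1].
pose f s := log_kernel s t - \sum_(i < n) s ^+ i.+1 / i.+1%:R * cos (i.+1%:R * t).
pose df s := s ^+ n * (cos (n.+1%:R * t) - s * cos (n%:R * t)) / poisson_den s t.
have f0 : f 0 = 0.
  rewrite /f /log_kernel /poisson_den mulr0 mul0r subr0 expr0n addr0 ln1 oppr0 mul0r.
  by rewrite big1 ?subrr// => i _; rewrite expr0n !mul0r.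
have den0 s : 0 <= s <= r -> 0 < poisson_den s t.
  by move=> /andP[s0 sr]; apply: poisson_den_gt0; rewrite s0 (le_lt_trans sr).
have Df s : 0 <= s <= r -> has_deriv f s (df s).
  move=> sr; have q0 := den0 s sr.
  have Dq : has_deriv (poisson_den^~ t) s (- (2 * cos t) + 2 * s).
    rewrite /poisson_den.
    apply: (deriv_eq (a := 0 - (2 * cos t) * 1 + 2%:R * s ^+ 1)).
      apply: derivD; last exact: deriv_exp.
      apply: derivB; first exact: deriv_cst.
      rewrite [X in has_deriv X _ _](_ : _ = fun y => (2 * cos t) * y).
        by apply: derivZ; exact: deriv_id.
      by apply/funext => y; ring.
    by rewrite sub0r mulr1 expr1.
  apply: (deriv_eq (a :=
    (- 2^-1) * ((poisson_den s t)^-1 * (- (2 * cos t) + 2 * s)) -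
     \sum_(i < n) s ^+ i * cos (i.+1%:R * t))).
    apply: derivB.
      rewrite /log_kernel [X in has_deriv X _ _](_ : _ =
          fun y => (- 2^-1) * ln (poisson_den y t)).
        apply: derivZ.
        exact (@deriv_comp _ (@ln R) (poisson_den^~ t) s _ _ (is_derive1_ln q0) Dq).
      by apply/funext => y; rewrite mulNr mulNr mulrC.
    apply: (@deriv_sum _ _ _ (fun i s => s ^+ i * cos (i.+1%:R * t))) => i.
    rewrite [X in has_deriv X _ _](_ : _ = fun y => (cos (i.+1%:R * t) / i.+1%:R) * y ^+ i.+1).
      apply: (deriv_eq (a := (cos (i.+1%:R * t) / i.+1%:R) * (i.+1%:R * s ^+ i))).
        by apply: derivZ; exact: deriv_exp.
      by rewrite mulrA divfK ?pnatr_eq0// mulrC.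
    by apply/funext => y; ring.
  rewrite /df -cos_geometric_sum; field; exact: lt0r_neq0.
have dfM s : 0 <= s <= r -> `|df s| <= 2 * r ^+ n / (1 - r) ^+ 2.
  move=> sr; have q0 := den0 s sr; move/andP: (sr) => [s0 s_r].
  rewrite /df normrM normrM normfV (gtr0_norm q0) ger0_norm ?exprn_ge0//.
  apply: ler_pM; rewrite ?invr_ge0 ?mulr_ge0 ?exprn_ge0 ?(ltW q0)//.
    rewrite [leRHS]mulrC; apply: ler_pM; rewrite ?exprn_ge0//.
      by rewrite lerXn2r ?nnegrE.
    have := cos_max (n.+1%:R * t); have := cos_max (n%:R * t).
    rewrite !ler_norml; nra.
  rewrite lef_pV2 ?posrE ?exprn_gt0 ?subr_gt0//.
  apply: le_trans (poisson_den_ge _ s0); nra.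
have := MVT_bound r0 Df dfM; rewrite f0 !subr0 => /le_trans; apply.
by rewrite ler_piMr ?(ltW r1)// mulr_ge0 ?invr_ge0 ?mulr_ge0 ?exprn_ge0 ?subr_ge0 ?(ltW r1).
Qed.

End log_kernel.

(** * Fejer sums of cos (n t) / n ^ 2 *)

Section fejer.
Context {R : realType}.
Implicit Types (s t e : R).

Lemma sin_natpi n : sin (n%:R * pi) = 0 :> R.
Proof.
have := alternatingn (@sinDpi R) n 0.
by rewrite add0r mulr_natl sin0 mulr0.
Qed.

Lemma cos_reflect n t : cos (n%:R * (2 * pi - t)) = cos (n%:R * t).
Proof.
have -> : n%:R * (2 * pi - t) = - (n%:R * t) + (pi *+ 2) *+ n.
  by rewrite mulrBr addrC -[(pi *+ 2) *+ n]mulr_natl -[pi *+ 2]mulr_natl.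
by rewrite (periodicn (@cosD2pi R)) cosN.
Qed.

(** The Dirichlet kernel in a form free of division, valid also at t = 0. *)
Lemma dirichlet_kernel n t :
  (1 - cos t) * (1 + 2 * \sum_(i < n) cos (i.+1%:R * t)) =
  cos (n%:R * t) - cos (n.+1%:R * t).
Proof.
elim: n => [|n IHn].
  by rewrite big_ord0 mulr0 addr0 mulr1 mul0r cos0 mul1r.
rewrite big_ord_recr/= [2 * (_ + _)]mulrDr addrA mulrDr IHn.
have -> : cos (n.+2%:R * t) = 2 * cos t * cos (n.+1%:R * t) - cos (n%:R * t).
  by rewrite -cos_rec addrK.
ring.
Qed.

(** The Fejer kernel: the sum of the Dirichlet kernels of order at most n. Its
    positivity, and its smallness away from t = 0, are read off the right-hand
    side. *)
Lemma fejer_kernel n t :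
  (1 - cos t) * (n.+1%:R + 2 * \sum_(i < n) (n.+1%:R - i.+1%:R) * cos (i.+1%:R * t)) =
  1 - cos (n.+1%:R * t).
Proof.
elim: n => [|n IHn]; first by rewrite big_ord0 mulr0 addr0 mulr1 mul1r.
have -> : \sum_(i < n.+1) (n.+2%:R - i.+1%:R) * cos (i.+1%:R * t) =
    \sum_(i < n) (n.+1%:R - i.+1%:R) * cos (i.+1%:R * t) +
    \sum_(i < n.+1) cos (i.+1%:R * t).
  rewrite (_ : \sum_(i < n) _ =
      \sum_(i < n.+1) (n.+1%:R - i.+1%:R) * cos (i.+1%:R * t)); last first.
    by rewrite big_ord_recr/= subrr mul0r addr0.
  rewrite -big_split/=; apply: eq_bigr => i _.
  by rewrite -[n.+2%:R]natr1; ring.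
transitivity ((1 - cos t) * (n.+1%:R + 2 * \sum_(i < n) (n.+1%:R - i.+1%:R) * cos (i.+1%:R * t))
   + (1 - cos t) * (1 + 2 * \sum_(i < n.+1) cos (i.+1%:R * t))).
  by rewrite -[n.+2%:R]natr1; ring.
by rewrite IHn dirichlet_kernel; ring.
Qed.

(** The Cesaro means of sum_i cos (i t) / i ^ 2. The Cesaro weights make the
    second derivative a constant minus half a Fejer kernel, instead of an
    oscillating Dirichlet kernel. *)
Definition fejer_sum n t : R :=
  \sum_(i < n) (n.+1%:R - i.+1%:R) / n.+1%:R / i.+1%:R ^+ 2 * cos (i.+1%:R * t).

Lemma fejer_sum_reflect n t : fejer_sum n (2 * pi - t) = fejer_sum n t.
Proof. by apply: eq_bigr => i _; rewrite cos_reflect. Qed.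

Let err n t := fejer_sum n t - fejer_sum n pi - (t - pi) ^+ 2 / 4.

Let derr n t := - (\sum_(i < n) (n.+1%:R - i.+1%:R) / n.+1%:R / i.+1%:R * sin (i.+1%:R * t))
  - (t - pi) / 2.

Let dderr n t :=
  - (n.+1%:R + 2 * \sum_(i < n) (n.+1%:R - i.+1%:R) * cos (i.+1%:R * t)) / (2 * n.+1%:R).

Let has_deriv_err n t : has_deriv (err n) t (derr n t).
Proof.
apply: derivB.
  rewrite -[X in has_deriv _ _ X]subr0; apply: derivB; last exact: deriv_cst.
  rewrite -sumrN.
  apply: (@deriv_sum _ _ _ (fun i s =>
    - ((n.+1%:R - i.+1%:R) / n.+1%:R / i.+1%:R * sin (i.+1%:R * s)))) => i.
  apply: (deriv_eq (a := ((n.+1%:R - i.+1%:R) / n.+1%:R / i.+1%:R ^+ 2) *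
      (- (i.+1%:R * sin (i.+1%:R * t))))).
    by apply: derivZ; exact: deriv_cosM.
  have h : i.+1%:R != 0 :> R by rewrite pnatr_eq0.
  by rewrite mulrN expr2 invfM !mulrA divfK.
apply: (deriv_eq (a := 4^-1 * ((2%:R * (t - pi) ^+ 1) * (1 - 0)))).
  rewrite [X in has_deriv X _ _](_ : _ = fun y => 4^-1 * (y - pi) ^+ 2); last first.
    by apply/funext => y; rewrite mulrC.
  apply: derivZ.
  exact (@deriv_comp _ (fun y => y ^+ 2) (fun y => y - pi) t _ _
    (deriv_exp 2 (t - pi)) (derivB (deriv_id t) (deriv_cst t pi))).
by field.
Qed.

Let has_deriv_derr n t : has_deriv (derr n) t (dderr n t).
Proof.
have n0 : n.+1%:R != 0 :> R by rewrite pnatr_eq0.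
rewrite /derr.
apply: (deriv_eq (a := \sum_(i < n)
    - ((n.+1%:R - i.+1%:R) / n.+1%:R * cos (i.+1%:R * t)) - 2^-1 * (1 - 0))).
  apply: derivB.
    rewrite [X in has_deriv X _ _](_ : _ = fun y => \sum_(i < n)
        - ((n.+1%:R - i.+1%:R) / n.+1%:R / i.+1%:R * sin (i.+1%:R * y))); last first.
      by apply/funext => y; rewrite sumrN.
    apply: (@deriv_sum _ _ _ (fun i s =>
      - ((n.+1%:R - i.+1%:R) / n.+1%:R * cos (i.+1%:R * s)))) => i.
    rewrite [X in has_deriv X _ _](_ : _ = fun y =>
        - ((n.+1%:R - i.+1%:R) / n.+1%:R / i.+1%:R) * sin (i.+1%:R * y)); last first.
      by apply/funext => y; rewrite mulNr.
    apply: (deriv_eq (a := - ((n.+1%:R - i.+1%:R) / n.+1%:R / i.+1%:R) *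
        (i.+1%:R * cos (i.+1%:R * t)))).
      by apply: derivZ; exact: deriv_sinM.
    have h : i.+1%:R != 0 :> R by rewrite pnatr_eq0.
    by rewrite mulNr !mulrA divfK.
  rewrite [X in has_deriv X _ _](_ : _ = fun y => 2^-1 * (y - pi)); last first.
    by apply/funext => y; rewrite mulrC.
  by apply: derivZ; apply: derivB; [exact: deriv_id|exact: deriv_cst].
rewrite /dderr subr0 mulr1.
rewrite (_ : \sum_(i < n) - _ =
    - (n.+1%:R^-1 * \sum_(i < n) (n.+1%:R - i.+1%:R) * cos (i.+1%:R * t))).
  by move: (\sum_(i < n) _) => S; move: n.+1%:R n0 => k k0; field.
rewrite sumrN mulr_sumr; congr (- _); apply: eq_bigr => i _.
by rewrite mulrA [_^-1 * _]mulrC.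
Qed.

Let derr_pi n : derr n pi = 0.
Proof.
rewrite /derr subrr mul0r subr0 big1 ?oppr0// => i _.
by rewrite sin_natpi mulr0.
Qed.

Let derr0 n : derr n 0 = pi / 2.
Proof.
rewrite /derr big1 ?oppr0 ?add0r ?mulNr ?opprK// => i _.
by rewrite mulr0 sin0 mulr0.
Qed.

Let err_pi n : err n pi = 0.
Proof. by rewrite /err !subrr expr0n mul0r subr0. Qed.

(** The second derivative of the error is, up to a negative factor, the Fejer
    kernel. *)
Let dderr_bound n s t : 0 < s -> s <= t -> t < pi ->
  0 <= - dderr n t <= 1 / (n.+1%:R * (1 - cos s)).
Proof.
move=> s0 st tpi.
have cos_lt (u : R) : 0 < u -> u < pi -> 0 < 1 - cos u.
  move=> u0 upi; rewrite subr_gt0 -(@cos0 R) ltr_cos// in_itv/= ?lexx ?pi_ge0//.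
  by rewrite !ltW.
have cs := cos_lt s s0 (le_lt_trans st tpi).
have ct := cos_lt t (lt_le_trans s0 st) tpi.
have cst : 1 - cos s <= 1 - cos t.
  rewrite lerD2l lerN2; move: st; rewrite le_eqVlt => /predU1P[->//|st].
  have sI : s \in `[0, pi] by rewrite in_itv/= !ltW// (lt_trans st).
  have tI : t \in `[0, pi] by rewrite in_itv/= !ltW// (lt_trans s0).
  by rewrite ltW// ltr_cos.
have n0 : 0 < n.+1%:R :> R by rewrite ltr0n.
have -> : - dderr n t = (1 - cos (n.+1%:R * t)) / (2 * n.+1%:R * (1 - cos t)).
  rewrite -fejer_kernel /dderr.
  move: (n.+1%:R + _) => F; move: n.+1%:R n0 => k k0.
  by field; rewrite !lt0r_neq0.
have c1 := cos_le1 (n.+1%:R * t); have c2 := cos_geN1 (n.+1%:R * t).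
apply/andP; split.
  by rewrite divr_ge0 ?subr_ge0// mulr_ge0 ?mulr_ge0// ltW.
rewrite ler_pdivrMr ?mulr_gt0// mul1r ler_pdivlMl ?mulr_gt0//.
move: (cos (_ * t)) c1 c2 => x c1 c2.
move: n.+1%:R n0 => k k0.
have : 0 <= k * (1 - cos t) by rewrite mulr_ge0// ltW.
have : k * (1 - cos s) <= k * (1 - cos t) by rewrite ler_wpM2l// ltW.
nra.
Qed.

Let derr_decr n s t : 0 <= s -> s < t -> t <= pi ->
  exists2 c, s < c < t & derr n s - derr n t = - dderr n c * (t - s).
Proof.
move=> s0 st tpi.
have [||c] := @MVT R (derr n) (dderr n) s t st.
- by move=> x _; exact: has_deriv_derr.
- exact/continuous_subspaceT/(has_deriv_continuous (has_deriv_derr n)).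
rewrite in_itv/= => ct E; exists c => //.
by rewrite -[LHS]opprB E [RHS]mulNr.
Qed.

Let derr_ge0 n t : 0 <= t <= pi -> 0 <= derr n t.
Proof.
move=> /andP[t0]; rewrite le_eqVlt => /predU1P[->|tpi]; first by rewrite derr_pi.
have [c /andP[tc cpi]] := derr_decr n t0 tpi (lexx _).
rewrite derr_pi subr0 => ->; rewrite mulr_ge0 ?subr_ge0 ?(ltW tpi)//.
by have /andP[] := dderr_bound n (le_lt_trans t0 tc) (lexx _) cpi.
Qed.

Let derr_le n t : 0 <= t <= pi -> derr n t <= pi / 2.
Proof.
move=> /andP[]; rewrite le_eqVlt => /predU1P[<-|t0 tpi]; first by rewrite derr0.
have [c /andP[tc cpi]] := derr_decr n (lexx _) t0 tpi.
rewrite derr0 -subr_ge0 => ->; rewrite mulr_ge0 ?subr_ge0 ?(ltW t0)//.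
by have /andP[] := dderr_bound n tc (lexx _) (lt_le_trans cpi tpi).
Qed.

Let derr_small n s t : 0 < s -> s <= t <= pi ->
  derr n t <= pi / (n.+1%:R * (1 - cos s)).
Proof.
move=> s0 /andP[st]; rewrite le_eqVlt => /predU1P[->|tpi].
  by rewrite derr_pi divr_ge0 ?pi_ge0// mulr_ge0// subr_ge0 cos_le1.
have t0 : 0 < t by exact: lt_le_trans st.
have [c /andP[tc cpi]] := derr_decr n (ltW t0) tpi (lexx _).
rewrite derr_pi subr0 => ->.
have /andP[c0 c1] := dderr_bound n s0 (le_trans st (ltW tc)) cpi.
rewrite mulrC; apply: ler_pM => //; first by rewrite subr_ge0 ltW.
  by rewrite lerBlDr lerDl ltW.
by rewrite -[leRHS]mul1r.
Qed.

(** The error vanishes at pi. Its derivative is small on [s, pi], where the Fejer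
    kernel is, and at most pi / 2 on [0, s]. *)
Let err_half n s t : 0 < s -> s <= pi -> 0 <= t <= pi ->
  `|err n t| <= pi / 2 * s + pi / (n.+1%:R * (1 - cos s)) * pi.
Proof.
move=> s0 spi /andP[t0 tpi].
have B0 : 0 <= pi / (n.+1%:R * (1 - cos s)).
  by rewrite divr_ge0 ?pi_ge0// mulr_ge0// subr_ge0 cos_le1.
pose u := Num.max s t.
have upi : u <= pi by rewrite ge_max spi.
have su : s <= u by rewrite le_max lexx.
have tu : t <= u by rewrite le_max lexx orbT.
have u0 : 0 <= u by rewrite (le_trans _ su) ?ltW.
have -> : err n t = - (err n u - err n t) - (err n pi - err n u).
  by rewrite err_pi; ring.
apply: (le_trans (ler_normB _ _)); rewrite normrN; apply: lerD.
  apply: (@le_trans _ _ (pi / 2 * (u - t))).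
    apply: (MVT_bound tu (fun x _ => has_deriv_err n x)) => x /andP[tx xu].
    have x0 : 0 <= x <= pi by rewrite (le_trans t0)// (le_trans xu).
    by rewrite ger0_norm ?derr_ge0// derr_le.
  rewrite ler_wpM2l ?divr_ge0 ?pi_ge0//.
  rewrite /u /Num.max; case: ifPn; lra.
apply: (@le_trans _ _ (pi / (n.+1%:R * (1 - cos s)) * (pi - u))).
  apply: (MVT_bound upi (fun x _ => has_deriv_err n x)) => x /andP[ux xpi].
  rewrite ger0_norm; last by rewrite derr_ge0// (le_trans u0).
  by rewrite derr_small// (le_trans su).
by rewrite ler_wpM2l// lerBlDr lerDl.
Qed.

(** The Fourier series (t - pi) ^ 2 / 4 = pi ^ 2 / 12 + sum_i cos (i t) / i ^ 2,
    up to the value at pi, uniformly on [0, 2 pi]. *)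
Lemma fejer_sum_cvg e : 0 < e -> exists n, forall t, 0 <= t <= 2 * pi ->
  `|fejer_sum n t - fejer_sum n pi - (t - pi) ^+ 2 / 4| <= e.
Proof.
move=> e0.
(* The window [0, s] costs at most e / 2, and n makes the rest at most e / 2. *)
pose s : R := Num.min 1 (e / pi).
have s0 : 0 < s by rewrite lt_min ltr01 divr_gt0 ?pi_gt0.
have s1 : s <= 1 by rewrite ge_min lexx.
have spi : s <= pi by rewrite (le_trans s1)// (le_trans _ (pi_ge2 R))// ler1n.
have cs : 0 < 1 - cos s.
  rewrite subr_gt0 -(@cos0 R) ltr_cos// in_itv/= ?lexx ?pi_ge0//.
  by rewrite ltW.
pose K := 2 * pi * pi / (e * (1 - cos s)).
have K0 : 0 <= K by rewrite divr_ge0 ?mulr_ge0 ?pi_ge0// ltW.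
pose n := Num.truncn K; exists n.
have Kn : K <= n.+1%:R by rewrite ltW// truncnS_gt.
have H t : 0 <= t <= pi -> `|fejer_sum n t - fejer_sum n pi - (t - pi) ^+ 2 / 4| <= e.
  move=> tpi; apply: (le_trans (err_half n s0 spi tpi)).
  have -> : e = e / 2 + e / 2 by field.
  apply: lerD.
    rewrite mulrAC ler_wpM2r// mulrC -ler_pdivlMr ?pi_gt0//.
    by rewrite ge_min lexx orbT.
  rewrite mulrAC ler_pdivrMr ?mulr_gt0//.
  move: Kn; rewrite /K ler_pdivrMr ?mulr_gt0//.
  move: n.+1%:R (1 - cos s) => k c; lra.
move=> t /andP[t0 t2]; have [tpi|pit] := leP t pi; first by rewrite H// t0.
rewrite -fejer_sum_reflect -[t - pi]opprB sqrrN.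
rewrite (_ : pi - t = (2 * pi - t) - pi); last by ring.
apply: H; lra.
Qed.

End fejer.

(** * Bounded measurable functions and their means *)

Section bounded_measurable.
Context d (T : measurableType d) {R : realType}.
Implicit Types (f g : T -> R) (k : R) (P : probability T R).

(** A class of integrands that is stable under the ring operations and under
    partial integration, and integrable for every probability. *)
Definition bmeas f := measurable_fun setT f /\ exists M, forall x, `|f x| <= M.

Lemma bmeas_cst k : bmeas (fun=> k).
Proof. by split => //; exists `|k|. Qed.

Lemma bmeasD f g : bmeas f -> bmeas g -> bmeas (fun x => f x + g x).
Proof.
move=> [mf [M fM]] [mg [N gN]]; split; first exact: measurable_funD.
by exists (M + N) => x; rewrite (le_trans (ler_normD _ _))// lerD.
Qed.

Lemma bmeasM f g : bmeas f -> bmeas g -> bmeas (fun x => f x * g x).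
Proof.
move=> [mf [M fM]] [mg [N gN]]; split; first exact: measurable_funM.
by exists (M * N) => x; rewrite normrM ler_pM.
Qed.

Lemma bmeasZ k f : bmeas f -> bmeas (fun x => k * f x).
Proof. by move=> mf; apply: bmeasM => //; exact: bmeas_cst. Qed.

Lemma bmeasN f : bmeas f -> bmeas (fun x => - f x).
Proof.
move=> [mf [M fM]]; split; first exact: measurableT_comp.
by exists M => x; rewrite normrN.
Qed.

Lemma bmeasB f g : bmeas f -> bmeas g -> bmeas (fun x => f x - g x).
Proof. by move=> mf mg; apply: bmeasD => //; exact: bmeasN. Qed.

Lemma bmeas_norm f : bmeas f -> bmeas (fun x => `|f x|).
Proof.
move=> [mf [M fM]]; split; first exact: measurableT_comp.
by exists M => x; rewrite normr_id.
Qed.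

Lemma bmeas_sum n (F : 'I_n -> T -> R) : (forall i, bmeas (F i)) ->
  bmeas (fun x => \sum_(i < n) F i x).
Proof.
move=> mF; elim: n F mF => [|n IHn] F mF.
  rewrite (_ : (fun _ => _) = fun=> 0); first exact: bmeas_cst.
  by apply/funext => x; rewrite big_ord0.
rewrite (_ : (fun _ => _) = fun x => \sum_(i < n) F (widen_ord (leqnSn n) i) x + F ord_max x).
  by apply: bmeasD => //; exact: (IHn (fun i => F (widen_ord (leqnSn n) i))).
by apply/funext => x; rewrite big_ord_recr.
Qed.

Lemma bmeas_indic (A : set T) : measurable A -> bmeas (\1_A : T -> R).
Proof.
move=> mA; split; first exact: measurable_indic.
by exists 1 => x; rewrite indicE; case: (x \in A); rewrite ?normr1 ?normr0.
Qed.

Variable P : probability T R.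

Lemma bmeas_integrable f : bmeas f -> P.-integrable setT (EFin \o f).
Proof.
move=> [mf [M fM]]; apply: measurable_bounded_integrable => //.
  by rewrite (le_lt_trans (probability_le1 _ _))// ltry.
exists M; split; first exact: num_real.
by move=> N MN x _ /=; exact: le_trans (fM x) (ltW MN).
Qed.

Lemma EFin_Rintegral f : bmeas f -> (\int[P]_x f x)%:E = (\int[P]_x (f x)%:E)%E.
Proof. by move=> bf; rewrite fineK// integrable_fin_num//; exact: bmeas_integrable. Qed.

Lemma mean_cst k : \int[P]_x k = k.
Proof. by rewrite Rintegral_cst// [X in fine X]probability_setT mulr1. Qed.

Lemma meanD f g : bmeas f -> bmeas g ->
  \int[P]_x (f x + g x) = \int[P]_x f x + \int[P]_x g x.
Proof. by move=> bf bg; rewrite RintegralD//; exact: bmeas_integrable. Qed.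

Lemma meanB f g : bmeas f -> bmeas g ->
  \int[P]_x (f x - g x) = \int[P]_x f x - \int[P]_x g x.
Proof. by move=> bf bg; rewrite RintegralB//; exact: bmeas_integrable. Qed.

Lemma meanZ k f : bmeas f -> \int[P]_x (k * f x) = k * \int[P]_x f x.
Proof. by move=> bf; rewrite RintegralZl//; exact: bmeas_integrable. Qed.

Lemma mean_sum n (F : 'I_n -> T -> R) : (forall i, bmeas (F i)) ->
  \int[P]_x (\sum_(i < n) F i x) = \sum_(i < n) \int[P]_x F i x.
Proof.
move=> mF; elim: n F mF => [|n IHn] F mF.
  rewrite big_ord0 -[RHS](mean_cst 0); apply: eq_Rintegral => x _.
  by rewrite big_ord0.
rewrite big_ord_recr/= -IHn// -meanD//; last exact: bmeas_sum.
by apply: eq_Rintegral => x _; rewrite big_ord_recr.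
Qed.

Lemma le_mean f g : bmeas f -> bmeas g -> (forall x, f x <= g x) ->
  \int[P]_x f x <= \int[P]_x g x.
Proof. by move=> bf bg fg; apply: le_Rintegral => //; exact: bmeas_integrable. Qed.

Lemma norm_mean_le f k : bmeas f -> (forall x, `|f x| <= k) -> `|\int[P]_x f x| <= k.
Proof.
move=> bf fk; apply: (le_trans (le_normr_Rintegral _ _)) => //.
  exact: bmeas_integrable.
rewrite -[leRHS](mean_cst k); apply: le_mean => //; last exact: bmeas_cst.
exact: bmeas_norm.
Qed.

Lemma mean_indic (A : set T) : measurable A -> \int[P]_x \1_A x = fine (P A).
Proof. by move=> mA; rewrite /Rintegral integral_indic// setIT. Qed.

End bounded_measurable.

Lemma bmeas_comp d1 d2 (T1 : measurableType d1) (T2 : measurableType d2)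
    (R : realType) (f : T2 -> R) (g : T1 -> T2) :
  bmeas f -> measurable_fun setT g -> bmeas (fun x => f (g x)).
Proof.
move=> [mf [M fM]] mg; split; last by exists M.
exact: measurableT_comp.
Qed.

Lemma mean_pushforward d1 d2 (T1 : measurableType d1) (T2 : measurableType d2)
    (R : realType) (P : probability T1 R) (Q : probability T2 R) (X : T1 -> T2)
    (f : T2 -> R) : measurable_fun setT X -> bmeas f ->
  (forall A, measurable A -> pushforward P X A = Q A) ->
  \int[P]_z f (X z) = \int[Q]_x f x.
Proof.
move=> mX bf PQ; congr fine.
have mf : measurable_fun setT (EFin \o f) by apply/measurable_EFinP; case: bf.
have H := integral_pushforward mX mf (bmeas_integrable P (bmeas_comp bf mX)) measurableT.
rewrite preimage_setT in H; rewrite -[LHS]H.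
by apply: eq_measure_integral => A mA _; exact: PQ.
Qed.

Section product_mean.
Context d1 d2 (T1 : measurableType d1) (T2 : measurableType d2) {R : realType}.
Variables (P : probability T1 R) (Q : probability T2 R).
Implicit Types h : T1 * T2 -> R.

Let PQ : probability (T1 * T2)%type R := (P \x Q)%E.

Lemma bmeas_section1 h x : bmeas h -> bmeas (fun y => h (x, y)).
Proof. by move=> bh; apply: bmeas_comp => //; exact: pair1_measurable. Qed.

Lemma bmeas_section2 h y : bmeas h -> bmeas (fun x => h (x, y)).
Proof. by move=> bh; apply: bmeas_comp => //; exact: pair2_measurable. Qed.

Lemma bmeas_mean2 h : bmeas h -> bmeas (fun x => \int[Q]_y h (x, y)).
Proof.
move=> bh; have [_ [M hM]] := bh; split; last first.
  by exists M => x; apply: norm_mean_le => //; exact: bmeas_section1.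
apply/measurable_EFinP.
rewrite (_ : _ \o _ = fubini_F Q (EFin \o h)).
  by apply: (@measurable_fubini_F _ _ _ _ _ P); exact: (bmeas_integrable PQ).
apply/funext => x; rewrite /= EFin_Rintegral//; exact: bmeas_section1.
Qed.

Lemma bmeas_mean1 h : bmeas h -> bmeas (fun y => \int[P]_x h (x, y)).
Proof.
move=> bh; have [_ [M hM]] := bh; split; last first.
  by exists M => x; apply: norm_mean_le => //; exact: bmeas_section2.
apply/measurable_EFinP.
rewrite (_ : _ \o _ = fubini_G P (EFin \o h)).
  by apply: (@measurable_fubini_G _ _ _ _ _ _ Q); exact: (bmeas_integrable PQ).
apply/funext => x; rewrite /= EFin_Rintegral//; exact: bmeas_section2.
Qed.

Lemma mean_prod12 h : bmeas h ->
  \int[PQ]_z h z = \int[P]_x (\int[Q]_y h (x, y)).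
Proof.
move=> bh; congr fine; rewrite /PQ -integral12_prod_meas1/=.
  apply: eq_integral => x _; rewrite /fubini_F EFin_Rintegral//.
  exact: bmeas_section1.
exact: (bmeas_integrable PQ).
Qed.

Lemma mean_prod21 h : bmeas h ->
  \int[PQ]_z h z = \int[Q]_y (\int[P]_x h (x, y)).
Proof.
move=> bh; congr fine; rewrite /PQ -integral21_prod_meas1/=.
  apply: eq_integral => x _; rewrite /fubini_G EFin_Rintegral//.
  exact: bmeas_section2.
exact: (bmeas_integrable PQ).
Qed.

Lemma mean_swap h : bmeas h ->
  \int[P]_x (\int[Q]_y h (x, y)) = \int[Q]_y (\int[P]_x h (x, y)).
Proof. by move=> bh; rewrite -mean_prod12// mean_prod21. Qed.

Lemma mean_prodM f g : bmeas f -> bmeas g ->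
  \int[PQ]_z (f z.1 * g z.2) = (\int[P]_x f x) * \int[Q]_y g y.
Proof.
move=> bf bg; rewrite mean_prod12/=; last first.
  by apply: bmeasM; exact: bmeas_comp.
transitivity (\int[P]_x ((\int[Q]_y g y) * f x)).
  by apply: eq_Rintegral => x _; rewrite meanZ// mulrC.
by rewrite meanZ// mulrC.
Qed.

End product_mean.

(** * The quadratic form of a signed measure *)

Section signed_double.
Context d (T : measurableType d) {R : realType}.
Variables (mu nu : probability T R).
Implicit Types (f g : T -> R) (h k : T * T -> R).

Definition smean f := \int[mu]_x f x - \int[nu]_x f x.

(** Integration against the product of mu - nu with itself, expanded by
    bilinearity. *)
Definition sdouble h := \int[(mu \x mu)%E]_z h z - \int[(mu \x nu)%E]_z h z
   - \int[(nu \x mu)%E]_z h z + \int[(nu \x nu)%E]_z h z.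

Lemma sdoubleM f g : bmeas f -> bmeas g ->
  sdouble (fun z => f z.1 * g z.2) = smean f * smean g.
Proof. by move=> bf bg; rewrite /sdouble /smean !mean_prodM//; ring. Qed.

Let alt4D (a b c e a' b' c' e' : R) :
  (a + a') - (b + b') - (c + c') + (e + e') = (a - b - c + e) + (a' - b' - c' + e').
Proof. ring. Qed.

Let alt4B (a b c e a' b' c' e' : R) :
  (a - a') - (b - b') - (c - c') + (e - e') = (a - b - c + e) - (a' - b' - c' + e').
Proof. ring. Qed.

Let alt4Z (k a b c e : R) : k * a - k * b - k * c + k * e = k * (a - b - c + e).
Proof. ring. Qed.

Let alt4_le (k a b c e : R) : `|a| <= k -> `|b| <= k -> `|c| <= k -> `|e| <= k ->
  `|a - b - c + e| <= 4 * k.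
Proof. rewrite !ler_norml; lra. Qed.

Lemma sdoubleD h k : bmeas h -> bmeas k ->
  sdouble (fun z => h z + k z) = sdouble h + sdouble k.
Proof. by move=> bh bk; rewrite /sdouble !meanD//; exact: alt4D. Qed.

Lemma sdoubleZ c h : bmeas h -> sdouble (fun z => c * h z) = c * sdouble h.
Proof. by move=> bh; rewrite /sdouble !meanZ//; exact: alt4Z. Qed.

Lemma sdoubleB h k : bmeas h -> bmeas k ->
  sdouble (fun z => h z - k z) = sdouble h - sdouble k.
Proof. by move=> bh bk; rewrite /sdouble !meanB//; exact: alt4B. Qed.

Lemma sdouble_sum n (F : 'I_n -> T * T -> R) : (forall i, bmeas (F i)) ->
  sdouble (fun z => \sum_(i < n) F i z) = \sum_(i < n) sdouble (F i).
Proof.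
by move=> bF; rewrite /sdouble !mean_sum// !(big_split, sumrN)/= .
Qed.

Lemma smean_cst c : smean (fun=> c) = 0.
Proof. by rewrite /smean !mean_cst subrr. Qed.

(** The signed measure mu - nu has total mass 0. *)
Lemma sdouble1 f : bmeas f -> sdouble (fun z => f z.1) = 0.
Proof.
move=> bf; transitivity (smean f * smean (fun=> 1)); last by rewrite smean_cst mulr0.
rewrite -sdoubleM//; last exact: bmeas_cst.
by congr sdouble; apply/funext => z; rewrite mulr1.
Qed.

Lemma sdouble2 f : bmeas f -> sdouble (fun z => f z.2) = 0.
Proof.
move=> bf; transitivity (smean (fun=> 1) * smean f); last by rewrite smean_cst mul0r.
rewrite -sdoubleM//; last exact: bmeas_cst.
by congr sdouble; apply/funext => z; rewrite mul1r.
Qed.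

(** Each of the four product measures is a probability. *)
Lemma sdouble_close h k c : bmeas h -> bmeas k -> (forall z, `|h z - k z| <= c) ->
  `|sdouble h - sdouble k| <= 4 * c.
Proof.
move=> bh bk hk; have bhk := bmeasB bh bk.
rewrite -sdoubleB// /sdouble.
by apply: alt4_le; exact: norm_mean_le.
Qed.

End signed_double.

(** * The angle coordinate on [-2, 2] *)

Section angle.
Context {R : realType}.
Implicit Types (x y t : R).

(** Half of the projection of x to [-2, 2]. Clamping makes the angle total and
    monotone on the line; supports only matter where x is recovered from it. *)
Definition clamp x : R := Num.max (- 1) (Num.min 1 (x / 2)).

Definition angle (x : measurableTypeR R) : R := acos (clamp x).

Lemma clamp_itv x : - 1 <= clamp x <= 1.
Proof. by rewrite /clamp le_max lexx/= ge_max ge_min lexx/= andbT; lra. Qed.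

Lemma clamp_id x : - 2 <= x <= 2 -> clamp x = x / 2.
Proof.
move=> /andP[x2 x_2]; rewrite /clamp min_r; last lra.
by rewrite max_r//; lra.
Qed.

Lemma le_clamp x y : x <= y -> clamp x <= clamp y.
Proof.
move=> xy; rewrite /clamp ge_max !le_max lexx/= le_min !ge_min lexx/=.
by rewrite (ler_wpM2r _ xy) ?invr_ge0// !orbT.
Qed.

(** Projecting to [-2, 2] does not increase distances. *)
Lemma clamp_lip x y : x <= y -> 2 * (clamp y - clamp x) <= y - x.
Proof.
move=> xy; rewrite /clamp /Num.max /Num.min.
by case: (ltP 1 (x / 2)) => ?; case: (ltP 1 (y / 2)) => ?; case: ltP => ?; case: ltP => ?; lra.
Qed.

Lemma cos_angle x : cos (angle x) = clamp x.
Proof. by rewrite acosK// in_itv/=; exact: clamp_itv. Qed.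

Lemma angle_itv x : 0 <= angle x <= pi.
Proof. by rewrite acos_ge0 ?acos_lepi ?clamp_itv. Qed.

Lemma angle_in x : angle x \in `[0, pi].
Proof. by rewrite in_itv/= angle_itv. Qed.

Lemma cos_angleK x : - 2 <= x <= 2 -> x = 2 * cos (angle x).
Proof. by move=> x2; rewrite cos_angle clamp_id// mulrCA divff ?mulr1. Qed.

Lemma angle_le t x : t \in `[0, pi] -> (angle x <= t) = (cos t <= clamp x).
Proof. by move=> tpi; rewrite !leNgt -cos_angle ltr_cos// ?angle_in. Qed.

Lemma angle_nincr x y : x <= y -> angle y <= angle x.
Proof. by move=> xy; rewrite angle_le ?angle_in// cos_angle le_clamp. Qed.

Lemma measurable_angle : measurable_fun setT angle.
Proof. by apply: nonincreasing_measurable => // x y; exact: angle_nincr. Qed.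

Lemma measurable_cos : measurable_fun setT (@cos R).
Proof. by apply: continuous_measurable_fun; exact: continuous_cos. Qed.

Lemma bmeas_cos d (T : measurableType d) (f : T -> R) :
  measurable_fun setT f -> bmeas (fun z => cos (f z)).
Proof.
move=> mf; split; first by apply: measurableT_comp => //; exact: measurable_cos.
by exists 1 => x; exact: cos_max.
Qed.

Lemma bmeas_angle : bmeas angle.
Proof.
split; first exact: measurable_angle.
by exists pi => x; have /andP[a0 a1] := angle_itv x; rewrite ger0_norm.
Qed.

Let TT := (measurableTypeR R * measurableTypeR R)%type.

Lemma measurable_angle1 : measurable_fun setT (fun z : TT => angle z.1).
Proof. by apply: measurableT_comp => //; exact: measurable_angle. Qed.

Lemma measurable_angle2 : measurable_fun setT (fun z : TT => angle z.2).
Proof. by apply: measurableT_comp => //; exact: measurable_angle. Qed.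

Lemma bmeas_cos_angle n : bmeas (fun x => cos (n%:R * angle x)).
Proof. by apply: bmeas_cos; apply: measurable_funM => //; exact: measurable_angle. Qed.

End angle.

(** * Chebyshev moments and the regularised energy *)

Section chebyshev_moments.
Context {R : realType}.
Variables (mu nu : borel_probability R).
Let TT := (measurableTypeR R * measurableTypeR R)%type.
Implicit Types (r t : R) (z : TT).

(** The integral of the n-th Chebyshev polynomial at x / 2 against mu - nu. *)
Definition moment n := smean mu nu (fun x => cos (n%:R * angle x)).

Definition cos_sum n (c : 'I_n -> R) t := \sum_(i < n) c i * cos (i.+1%:R * t).

Lemma cos_sum_even n (c : 'I_n -> R) t : cos_sum c `|t| = cos_sum c t.
Proof.
apply: eq_bigr => i _; congr (_ * _).
by rewrite -[LHS]cos_norm -[RHS]cos_norm !normrM normr_id.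
Qed.

(** Since cos (n (a + b)) + cos (n (a - b)) = 2 cos (n a) cos (n b), a function
    of a + b and a - b given by a cosine polynomial is a diagonal form in the
    moments. *)
Lemma sdouble_cos_sum n (c : 'I_n -> R) :
  sdouble mu nu (fun z => cos_sum c (angle z.1 + angle z.2) + cos_sum c (angle z.1 - angle z.2))
  = \sum_(i < n) 2 * c i * moment i.+1 ^+ 2.
Proof.
transitivity (sdouble mu nu (fun z => \sum_(i < n)
    (2 * c i) * (cos (i.+1%:R * angle z.1) * cos (i.+1%:R * angle z.2)))).
  congr sdouble; apply/funext => z; rewrite /cos_sum -big_split/=.
  apply: eq_bigr => i _; rewrite mulrDr mulrBr cosD cosB; ring.
have bc i (f : TT -> R) : measurable_fun setT f -> bmeas (fun z => cos (i%:R * f z)).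
  by move=> mf; apply: bmeas_cos; exact: measurable_funM.
rewrite sdouble_sum; last first.
  move=> i; apply: bmeasZ; apply: bmeasM; apply: bc.
    exact: measurable_angle1.
  exact: measurable_angle2.
apply: eq_bigr => i _; rewrite sdoubleZ; last first.
  apply: bmeasM; apply: bc; [exact: measurable_angle1|exact: measurable_angle2].
by rewrite (sdoubleM mu nu (bmeas_cos_angle i.+1) (bmeas_cos_angle i.+1)) expr2.
Qed.

(** A regularisation of - log |x - y|, to which it reduces at r = 1 when x and y
    are distinct: for x = 2 cos a and y = 2 cos b, x - y is up to sign the
    product of the chords 2 sin ((a + b) / 2) and 2 sin ((a - b) / 2). *)
Definition reg_kernel r z :=
  log_kernel r (angle z.1 + angle z.2) + log_kernel r (angle z.1 - angle z.2).

Lemma bmeas_log_kernel r (f : TT -> R) : 0 <= r < 1 -> measurable_fun setT f ->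
  bmeas (fun z => log_kernel r (f z)).
Proof.
move=> r01 mf; split.
  rewrite /log_kernel; apply: measurable_funM => //; apply: measurableT_comp => //.
  apply: measurableT_comp => //; rewrite /poisson_den.
  apply: measurable_funD => //; apply: measurable_funB => //.
  by apply: measurable_funM => //; have [] := bmeas_cos mf.
exists (`|ln ((1 - r) ^+ 2)| + `|ln (4 : R)|) => z; move: (f z) => t.
rewrite /log_kernel normrM normrN (@gtr0_norm _ 2^-1) ?invr_gt0//.
have q0 := poisson_den_gt0 t r01.
have /andP[r0 r1] := r01.
have l1 : ln ((1 - r) ^+ 2) <= ln (poisson_den r t).
  by rewrite ler_ln ?posrE ?exprn_gt0 ?subr_gt0// poisson_den_ge.
have l2 : ln (poisson_den r t) <= ln 4.
  by rewrite ler_ln ?posrE ?poisson_den_le4// r0 ltW.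
move: (ln _) (ln ((1 - r) ^+ 2)) (ln 4) l1 l2 => l a b al lb.
rewrite ler_pdivrMr//.
have := ler_norm b; have := ler_norm (- a); rewrite normrN => na nb.
have := normr_ge0 a; have := normr_ge0 b => b0 a0.
rewrite ler_norml; apply/andP; split; lra.
Qed.

Lemma bmeas_reg_kernel r : 0 <= r < 1 -> bmeas (reg_kernel r).
Proof.
move=> r01; apply: bmeasD; apply: bmeas_log_kernel => //.
  by apply: measurable_funD; [exact: measurable_angle1|exact: measurable_angle2].
by apply: measurable_funB; [exact: measurable_angle1|exact: measurable_angle2].
Qed.

Lemma bmeas_cos_sum n (c : 'I_n -> R) (f : TT -> R) : measurable_fun setT f ->
  bmeas (fun z => cos_sum c (f z)).
Proof.
move=> mf; apply: bmeas_sum => i; apply: bmeasZ.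
by apply: bmeas_cos; exact: measurable_funM.
Qed.

Let partial r n := \sum_(i < n) 2 * (r ^+ i.+1 / i.+1%:R) * moment i.+1 ^+ 2.

Lemma sdouble_reg_kernel_cvg r : 0 <= r < 1 ->
  partial r n @[n --> \oo] --> sdouble mu nu (reg_kernel r).
Proof.
move=> r01; have /andP[r0 r1] := r01.
apply/subr_cvg0/norm_cvg0P.
pose K := 16 / (1 - r) ^+ 2.
apply: (@squeeze_cvgr _ _ _ _ (fun=> 0) (fun n => K * r ^+ n)).
- apply: nearW => n; rewrite normr_ge0/= /partial.
  rewrite -(sdouble_cos_sum (fun i : 'I_n => r ^+ i.+1 / i.+1%:R)) distrC.
  rewrite (_ : K * r ^+ n = 4 * (2 * (2 * r ^+ n / (1 - r) ^+ 2))); last first.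
    by rewrite /K; ring.
  apply: sdouble_close.
  + exact: bmeas_reg_kernel.
  + apply: bmeasD; apply: bmeas_cos_sum.
      by apply: measurable_funD; [exact: measurable_angle1|exact: measurable_angle2].
    by apply: measurable_funB; [exact: measurable_angle1|exact: measurable_angle2].
  + move=> z; rewrite /reg_kernel opprD addrACA (le_trans (ler_normD _ _))//.
    by rewrite [leRHS]mulrDl mul1r lerD// log_kernel_expansion.
- exact: cvg_cst.
- rewrite -[X in _ --> X](mulr0 K); apply: cvgM; first exact: cvg_cst.
  by apply: cvg_expr; rewrite ger0_norm.
Qed.

(** The form is a series with nonnegative terms, hence at least its partial
    sums. *)
Lemma sdouble_reg_kernel_ge r n : 0 <= r < 1 ->
  \sum_(i < n) 2 * (r ^+ i.+1 / i.+1%:R) * moment i.+1 ^+ 2 <= sdouble mu nu (reg_kernel r).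
Proof.
move=> r01; have /andP[r0 r1] := r01.
have cv := sdouble_reg_kernel_cvg r01.
rewrite -(cvg_lim _ cv)//; apply: nondecreasing_cvgn_le => //; last first.
  by apply/cvg_ex; eexists; exact: cv.
apply/nondecreasing_seqP => m; rewrite /partial big_ord_recr/= lerDl.
by rewrite mulr_ge0 ?sqr_ge0// mulr_ge0// divr_ge0 ?exprn_ge0.
Qed.

Lemma sdouble_reg_kernel_ge0 r : 0 <= r < 1 -> 0 <= sdouble mu nu (reg_kernel r).
Proof. by move=> r01; have := sdouble_reg_kernel_ge 0 r01; rewrite big_ord0. Qed.

Lemma sdouble_reg_kernel_first r : 0 <= r < 1 -> (forall n, (2 <= n)%N -> moment n = 0) ->
  sdouble mu nu (reg_kernel r) = 2 * r * moment 1 ^+ 2.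
Proof.
move=> r01 m0; apply: (cvg_unique _ (sdouble_reg_kernel_cvg r01)) => //.
apply: cvg_near_cst; exists 1%N => // -[//|n] _; rewrite /partial.
rewrite /= big_ord_recl/= big1 ?addr0 ?expr1 ?divr1//.
by move=> i _; rewrite m0// expr0n mulr0.
Qed.

End chebyshev_moments.

(** * The entropy as a limit of regularised energies *)

Section log_energy.
Context {R : realType}.
Let TT := (measurableTypeR R * measurableTypeR R)%type.
Implicit Types (r s t : R) (z : TT) (mu nu : borel_probability R).

Definition square : set TT := `[(- 2)%R, 2%R]%classic `*` `[(- 2)%R, 2%R]%classic.

Lemma squareE z : square z -> (- 2 <= z.1 <= 2) /\ (- 2 <= z.2 <= 2).
Proof. by move=> [] /=; rewrite !in_itv/=. Qed.

Lemma log_distE z : log_dist z = (if z.1 == z.2 then -oo else (ln `|z.1 - z.2|)%:E)%E.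
Proof.
rewrite /log_dist; case: ifPn => [/eqP ->|z12]; first by rewrite subrr normr0 le0_lneNy.
by rewrite lne_EFin// normr_gt0 subr_eq0.
Qed.

Lemma measurable_log_dist : measurable_fun setT (@log_dist R).
Proof.
rewrite (_ : @log_dist R = fun z : TT => (if z.1 == z.2 then -oo else (ln `|z.1 - z.2|)%:E)%E).
  apply: measurable_fun_ifT => //.
    by apply: measurable_fun_eqr.
  apply/measurable_EFinP; apply: measurableT_comp => //; apply: measurableT_comp => //.
  exact: measurable_funB.
by apply/funext => z; rewrite log_distE.
Qed.

Lemma poisson_den1 t : poisson_den 1 t = 2 * (1 - cos t).
Proof. by rewrite /poisson_den; ring. Qed.

(** The product of the two squared chords is the squared distance
    4 (cos a - cos b) ^ 2. *)
Lemma poisson_den1_prod z : square z ->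
  poisson_den 1 (angle z.1 + angle z.2) * poisson_den 1 (angle z.1 - angle z.2) =
  `|z.1 - z.2| ^+ 2.
Proof.
move=> /squareE[z1 z2]; rewrite real_normK ?num_real//.
rewrite [in RHS](cos_angleK z1) [in RHS](cos_angleK z2).
rewrite !poisson_den1 cosD cosB.
transitivity (4 * ((1 - cos (angle z.1) * cos (angle z.2)) ^+ 2 -
    sin (angle z.1) ^+ 2 * sin (angle z.2) ^+ 2)); first by ring.
by rewrite !sin2cos2; ring.
Qed.

Lemma poisson_den1_gt0 z : square z -> z.1 != z.2 ->
  0 < poisson_den 1 (angle z.1 + angle z.2) /\ 0 < poisson_den 1 (angle z.1 - angle z.2).
Proof.
move=> sz z12.
have : 0 < `|z.1 - z.2| ^+ 2 by rewrite exprn_gt0// normr_gt0 subr_eq0.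
rewrite -poisson_den1_prod//.
have h t : 0 <= poisson_den 1 t by rewrite poisson_den1 mulr_ge0// subr_ge0 cos_le1.
move: (h (angle z.1 + angle z.2)) (h (angle z.1 - angle z.2)).
rewrite !le_eqVlt => /predU1P[<-|->]; first by rewrite mul0r ltxx.
by move=> /predU1P[<-|->//]; rewrite mulr0 ltxx.
Qed.

Lemma kernel1 z : square z -> z.1 != z.2 -> reg_kernel 1 z = - ln `|z.1 - z.2|.
Proof.
move=> sz z12; have [q1 q2] := poisson_den1_gt0 sz z12.
rewrite /reg_kernel /log_kernel -mulrDl -opprD -lnM ?posrE// poisson_den1_prod//.
rewrite lnXn ?normr_gt0 ?subr_eq0// -[_ *+ 2]mulr_natr mulNr mulfK//.
Qed.

(** The regularised chords are comparable to the chords, so the logarithm of the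
    distance dominates the regularised kernels, uniformly in r >= 1/2. *)
Lemma poisson_den_half r t : 2^-1 <= r <= 1 -> poisson_den 1 t / 2 <= poisson_den r t.
Proof.
move=> /andP[r0 r1]; rewrite poisson_den1 /poisson_den.
have := cos_le1 t; move: (cos t) => c c1; nra.
Qed.

Lemma kernel_le r z : 2^-1 <= r < 1 -> square z ->
  ((reg_kernel r z)%:E <= (ln 2)%:E - log_dist z)%E.
Proof.
move=> /andP[r0 r1] sz; rewrite log_distE; case: ifPn => [_|z12]; first by rewrite leey.
have r01 : 0 <= r < 1 by rewrite r1 andbT (le_trans _ r0).
have [q1 q2] := poisson_den1_gt0 sz z12.
rewrite -EFinB lee_fin -kernel1// /reg_kernel /log_kernel.
have h t : 0 < poisson_den 1 t -> ln (poisson_den 1 t) - ln 2 <= ln (poisson_den r t).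
  move=> qt; have qr : 0 < poisson_den r t by exact: poisson_den_gt0.
  rewrite -ln_div ?posrE// ler_ln ?posrE//; last by rewrite divr_gt0.
  by rewrite poisson_den_half// r0 ltW.
have := h _ q1; have := h _ q2; lra.
Qed.

Lemma kernel_ge r z : 0 <= r < 1 -> - ln 4 <= reg_kernel r z.
Proof.
move=> r01; have /andP[r0 r1] := r01.
have h t : ln (poisson_den r t) <= ln 4.
  have qr : 0 < poisson_den r t by exact: poisson_den_gt0.
  by rewrite ler_ln ?posrE// poisson_den_le4// r0 ltW.
rewrite /reg_kernel /log_kernel.
have := h (angle z.1 + angle z.2); have := h (angle z.1 - angle z.2); lra.
Qed.

Lemma log_dist_le z : square z -> (log_dist z <= (ln 4)%:E)%E.
Proof.
move=> /squareE[z1 z2]; rewrite log_distE; case: ifPn => [_|z12]; first by rewrite leNye.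
rewrite lee_fin ler_ln ?posrE ?normr_gt0 ?subr_eq0// ler_norml; lra.
Qed.

(** Radii that increase to 1 and are at least 1/2, as [kernel_le] requires. *)
Definition abel_radius n : R := 1 - n.+2%:R^-1.

Lemma radius_itv n : 2^-1 <= abel_radius n < 1.
Proof.
rewrite /abel_radius ltrBlDr ltrDl invr_gt0 ltr0n andbT lerBrDr.
have : (n.+2%:R : R)^-1 <= 2^-1 by rewrite lef_pV2 ?posrE// ler_nat.
move: n.+2%:R => k; lra.
Qed.

Lemma radius01 n : 0 <= abel_radius n < 1.
Proof. by have /andP[r0 ->] := radius_itv n; rewrite andbT (le_trans _ r0). Qed.

Lemma cvg_radius : abel_radius n @[n --> \oo] --> (1 : R).
Proof.
rewrite -[X in _ --> X]subr0; apply: cvgB; first exact: cvg_cst.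
by have := @cvg_harmonic R; rewrite -(cvg_shiftS (@harmonic R)); apply.
Qed.

Lemma log_kernel_cvg t : 0 < poisson_den 1 t ->
  log_kernel (abel_radius n) t @[n --> \oo] --> log_kernel 1 t.
Proof.
move=> q0; rewrite /log_kernel; apply: cvgM; last exact: cvg_cst.
apply: cvgN.
apply: (@cvg_comp _ _ _ (fun n => poisson_den (abel_radius n) t) (@ln R)); last first.
  exact: continuous_ln.
rewrite /poisson_den; apply: cvgD.
  apply: cvgB; first exact: cvg_cst.
  apply: cvgM; last exact: cvg_cst.
  by apply: cvgM; [exact: cvg_cst|exact: cvg_radius].
rewrite expr2; under eq_fun do rewrite expr2.
by apply: cvgM; exact: cvg_radius.
Qed.

(** On the diagonal the limit is +oo, since the regularised chord of a - b is
    1 - r there. *)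
Lemma kernel_cvg z : square z ->
  (reg_kernel (abel_radius n) z)%:E @[n --> \oo] --> (- log_dist z)%E.
Proof.
move=> sz; rewrite log_distE; case: ifPn => [/eqP z12|z12].
  have -> : (- -oo = +oo :> \bar R)%E by [].
  apply/cvgeryP/cvgryPge => A.
  have /cvgryPge/(_ (expR (A + ln 2)))[k _ kA] := @cvgr_idn R.
  exists k => // n kn; rewrite /= /reg_kernel z12 subrr /log_kernel.
  have r01 := radius01 n.
  have h1 : ln (poisson_den (abel_radius n) (angle z.2 + angle z.2)) <= 2 * ln 2.
    have -> : 2 * ln 2 = ln (4 : R).
      by rewrite mulr_natl -lnXn//; congr ln; ring.
    rewrite ler_ln ?posrE//; last exact: poisson_den_gt0.
    by rewrite poisson_den_le4//; have /andP[-> /ltW ->] := r01.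
  have -> : ln (poisson_den (abel_radius n) 0) = - (2 * ln (n.+2%:R)).
    rewrite /poisson_den cos0 /abel_radius.
    rewrite (_ : _ + _ = n.+2%:R^-1 ^+ 2); last by ring.
    by rewrite lnXn ?invr_gt0// lnV ?posrE// mulNrn mulr_natl.
  have : A + ln 2 <= ln n.+2%:R.
    rewrite -[leLHS]expRK ler_ln ?posrE ?expR_gt0//.
    by apply: (kA n.+2); rewrite /= (leq_trans kn)// ltnW.
  lra.
rewrite -EFinN -kernel1//; apply: cvg_EFin; first exact: nearW.
by have [q1 q2] := poisson_den1_gt0 sz z12; apply: cvgD; exact: log_kernel_cvg.
Qed.

Section support.
Variables (mu nu : borel_probability R).
Hypotheses (smu : supported_m22 mu) (snu : supported_m22 nu).

Lemma ae_square : {ae (mu \x nu)%E, forall z, square z}.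
Proof.
have msq : measurable square by exact: measurableX.
exists (~` square); split => //; first exact: measurableC.
have E : (mu \x nu)%E square = 1%E.
  by rewrite /square product_measure1E// [X in (X * _)%E]smu [X in (_ * X)%E]snu mul1e.
have := @probability_setC _ _ _ (mu \x nu)%E square msq.
by rewrite [X in (_ - X)%E]E subee.
Qed.

Lemma measurable_kernel r : 0 <= r < 1 -> measurable_fun setT (fun z => (reg_kernel r z)%:E).
Proof. by move=> r01; apply/measurable_EFinP; case: (bmeas_reg_kernel r01). Qed.

Let dom z : \bar R := ((ln 4)%:E + `|log_dist z|)%E.

Lemma norm_kernel_le r z : 2^-1 <= r < 1 -> square z ->
  (`|(reg_kernel r z)%:E| <= dom z)%E.
Proof.
move=> r01 sz; have /andP[r0 r1] := r01.
have r00 : 0 <= r < 1 by rewrite r1 andbT (le_trans _ r0).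
have := kernel_le r01 sz; have := kernel_ge z r00; rewrite /dom.
case: (log_dist z) => [l| |]//=; rewrite ?leey//.
rewrite -EFinB -EFinD !lee_fin => h1 h2.
have l2 : ln (2 : R) <= ln 4 by rewrite ler_ln ?posrE// ler_nat.
have l0 : 0 <= ln (2 : R) by rewrite ln_ge0// ler1n.
have := ler_norm (- l); rewrite normrN ler_norml => nl.
have := normr_ge0 l => ln0.
apply/andP; split; lra.
Qed.

Lemma log_dist_integrable (m : probability TT R) :
  (\int[m]_z `|log_dist z| < +oo)%E -> m.-integrable setT (@log_dist R).
Proof. by move=> h; apply/integrableP; split=> //; exact: measurable_log_dist. Qed.

Lemma integrable_dom (m : probability TT R) :
  (\int[m]_z `|log_dist z| < +oo)%E -> m.-integrable setT dom.
Proof.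
move=> h; apply: integrableD => //.
  by apply: (bmeas_integrable m); exact: bmeas_cst.
by apply: integrable_abse; exact: log_dist_integrable.
Qed.

Hypothesis fin : (\int[(mu \x nu)%E]_z `|log_dist z| < +oo)%E.

(** Dominated convergence with the bound log 4 + |log |x - y||. *)
Lemma kernel_energy_cvg :
  \int[(mu \x nu)%E]_z reg_kernel (abel_radius n) z @[n --> \oo] -->
    - fine (\int[(mu \x nu)%E]_z log_dist z)%E.
Proof.
have [|||||_ _ +] := @dominated_convergence _ _ R (mu \x nu)%E setT measurableT
  (fun n z => (reg_kernel (abel_radius n) z)%:E) (fun z => - log_dist z)%E dom.
- by move=> n; apply: measurable_kernel; exact: radius01.
- by apply: measurableT_comp => //; exact: measurable_log_dist.
- by apply: filterS ae_square => z sz _; exact: kernel_cvg.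
- exact: integrable_dom.
- apply: filterS ae_square => z sz n _; apply: norm_kernel_le => //.
  exact: radius_itv.
have lfin := integrable_fin_num measurableT (log_dist_integrable fin).
have -> : (\int[(mu \x nu)%E]_z (- log_dist z) = - \int[(mu \x nu)%E]_z log_dist z)%E.
  apply: integralN. refine (integrable_add_def measurableT (log_dist_integrable fin)).
rewrite -[X in (- X)%E]fineK// -EFinN => /fine_cvgP[_]; apply: cvg_trans.
by [].
Qed.

End support.

Lemma kernelC r x y : reg_kernel r (x, y) = reg_kernel r (y, x).
Proof.
rewrite /reg_kernel/= [angle y + _]addrC -[angle y - _]opprB; congr (_ + _).
by rewrite /log_kernel /poisson_den cosN.
Qed.

Lemma mean_kernelC mu nu r : 0 <= r < 1 ->
  \int[(nu \x mu)%E]_z reg_kernel r z = \int[(mu \x nu)%E]_z reg_kernel r z.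
Proof.
move=> r01; have bk := bmeas_reg_kernel r01.
rewrite (mean_prod21 nu mu bk) (mean_prod12 mu nu bk).
by apply: eq_Rintegral => x _; apply: eq_Rintegral => y _; exact: kernelC.
Qed.

(** Positivity of the regularised form bounds the regularised mixed energy by
    the average of the two self-energies, which are bounded uniformly in r;
    Fatou's lemma passes to the limit. *)
Lemma mixed_log_energy_finite mu nu : supported_m22 mu -> supported_m22 nu ->
  finite_log_energy mu -> finite_log_energy nu ->
  (\int[(mu \x nu)%E]_z `|log_dist z| < +oo)%E.
Proof.
move=> smu snu fmu fnu.
pose self (m : borel_probability R) := (\int[(m \x m)%E]_z ((ln 4)%:E + `|log_dist z|))%E.
have self_fin m : finite_log_energy m -> self m \is a fin_num.
  by move=> fm; apply: integrable_fin_num => //; exact: integrable_dom.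
have self_le m n : supported_m22 m -> finite_log_energy m ->
    \int[(m \x m)%E]_z reg_kernel (abel_radius n) z <= fine (self m).
  move=> sm fm; rewrite -lee_fin [leRHS]fineK ?self_fin// EFin_Rintegral; last first.
    by apply: bmeas_reg_kernel; exact: radius01.
  rewrite /self.
  apply: (@le_trans _ _ (\int[(m \x m)%E]_z `|(reg_kernel (abel_radius n) z)%:E|)%E).
    apply: le_integral => //.
    - by apply: bmeas_integrable; apply: bmeas_reg_kernel; exact: radius01.
    - apply: integrable_abse.
      by apply: bmeas_integrable; apply: bmeas_reg_kernel; exact: radius01.
    - by move=> z _; exact: lee_abs.
  apply: ae_ge0_le_integral => //.
  - apply: measurableT_comp => //; apply: measurable_kernel; exact: radius01.
  - by move=> z _; rewrite adde_ge0// lee_fin ln_ge0// ler1n.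
  - by have /integrableP[] := integrable_dom fm.
  - apply: filterS (ae_square sm sm) => z sz _; apply: norm_kernel_le => //.
    exact: radius_itv.
pose B := (fine (self mu) + fine (self nu)) / 2 + ln 4.
pose f n z := (reg_kernel (abel_radius n) z + ln 4)%:E.
have f0 n z : (0 <= f n z)%E.
  by rewrite lee_fin -lerBlDr sub0r kernel_ge// radius01.
have mf n : measurable_fun setT (f n).
  apply/measurable_EFinP; apply: measurable_funD => //.
  by case: (bmeas_reg_kernel (radius01 n)).
have fB n : (\int[(mu \x nu)%E]_z f n z <= B%:E)%E.
  have bk := bmeas_reg_kernel (radius01 n).
  rewrite /f -EFin_Rintegral; last by apply: bmeasD => //; exact: bmeas_cst.
  rewrite meanD//; last exact: bmeas_cst.
  rewrite mean_cst lee_fin lerD2r.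
  have := sdouble_reg_kernel_ge0 mu nu (radius01 n).
  rewrite /sdouble (mean_kernelC mu nu (radius01 n)).
  have := self_le mu n smu fmu; have := self_le nu n snu fnu.
  move: (Rintegral _ _ _) (Rintegral _ _ _) (Rintegral _ _ _) => a b c; lra.
have fat : (\int[(mu \x nu)%E]_z limn_einf (f^~ z) <= B%:E)%E.
  apply: (le_trans (fatou _ _ _ _)) => //.
  rewrite limn_einf_lim; apply: lime_le; first exact: is_cvg_einfs.
  apply: nearW => n; apply: le_trans (fB n).
  by apply: ereal_inf_lbound; exists n => /=.
have mlim : measurable_fun setT (fun z => limn_einf (f^~ z)).
  apply: (emeasurable_fun_cvg (fun n z => einfs (f^~ z) n)) => [n|z _].
    exact: measurable_fun_einfs.
  by rewrite limn_einf_lim; exact: is_cvg_einfs.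
have lim0 z : (0 <= limn_einf (f^~ z))%E.
  rewrite limn_einf_lim; apply: lime_ge; first exact: is_cvg_einfs.
  by apply: nearW => n; apply: le_ereal_inf_tmp => _ [k _ <-].
apply: (@le_lt_trans _ _ (\int[(mu \x nu)%E]_z (limn_einf (f^~ z) + (ln 4)%:E))%E).
  apply: ae_ge0_le_integral => //.
  - by apply: measurableT_comp => //; exact: measurable_log_dist.
  - by move=> z _; rewrite adde_ge0// lee_fin ln_ge0// ler1n.
  - exact: emeasurable_funD.
  apply: filterS (ae_square smu snu) => z sz _.
  have -> : limn_einf (f^~ z) = (- log_dist z + (ln 4)%:E)%E.
    have cv : (f n z @[n --> \oo] --> - log_dist z + (ln 4)%:E)%E.
      have D : (- log_dist z +? (ln 4)%:E)%E by rewrite fin_num_adde_defl.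
      exact: cvgeD D (kernel_cvg sz) (cvg_cst _).
    by have [] := cvg_limn_einf_sup cv.
  have := log_dist_le sz; have l4 : 0 <= ln (4 : R) by rewrite ln_ge0// ler1n.
  case: (log_dist z) => [l| |]//=; rewrite ?leey// !lee_fin => ll.
  rewrite ler_norml; apply/andP; split; lra.
rewrite ge0_integralD//; last by move=> z _; rewrite lee_fin ln_ge0// ler1n.
rewrite integral_cst// [X in (_ * X)%E]probability_setT mule1.
by rewrite (le_lt_trans (leeD2r _ fat))// -EFinD ltry.
Qed.

Lemma free_entropy_limit mu nu : supported_m22 mu -> supported_m22 nu ->
  finite_log_energy mu -> finite_log_energy nu ->
  exists2 h : R, free_entropy mu nu = h%:E &
    sdouble mu nu (reg_kernel (abel_radius n)) @[n --> \oo] --> h.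
Proof.
move=> smu snu fmu fnu.
have fmn := mixed_log_energy_finite smu snu fmu fnu.
have fnm := mixed_log_energy_finite snu smu fnu fmu.
pose L (m m' : borel_probability R) := fine (\int[(m \x m')%E]_z log_dist z)%E.
have LE (m m' : borel_probability R) : (\int[(m \x m')%E]_z `|log_dist z| < +oo)%E ->
    (\int[(m \x m')%E]_z log_dist z)%E = (L m m')%:E.
  by move=> fm; rewrite fineK//; apply: integrable_fin_num => //; exact: log_dist_integrable.
exists (- L mu mu - - L mu nu - - L nu mu + - L nu nu).
  rewrite /free_entropy asboolT// /signed_double_integral !LE//.
  by rewrite -!EFinB -EFinD -EFinN; congr EFin; ring.
rewrite /sdouble; apply: cvgD; last exact: kernel_energy_cvg.
apply: cvgB; last exact: kernel_energy_cvg.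
by apply: cvgB; exact: kernel_energy_cvg.
Qed.

End log_energy.

(** * Integration over the angle *)

Section angle_mean.
Context {R : realType}.
Implicit Types (a t : R) (f g G : R -> R).

Definition unif : borel_probability R := uniform_prob (@pi_gt0 R).

Lemma bmeas_le d (T : measurableType d) (f g : T -> R) :
  measurable_fun setT f -> measurable_fun setT g ->
  bmeas (fun x => (f x <= g x)%R%:R : R).
Proof.
move=> mf mg; split; last first.
  by exists 1 => x; case: (f x <= g x)%R; rewrite ?normr1 ?normr0.
rewrite (_ : (fun x => _) = fun x => if f x <= g x then 1 else 0); last first.
  by apply/funext => x; case: (_ <= _).
by apply: measurable_fun_ifT => //; exact: measurable_fun_ler.
Qed.

Lemma continuous_bmeas g M : continuous g -> (forall t, `|g t| <= M) ->
  bmeas (g : measurableTypeR R -> R).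
Proof. by move=> cg gM; split; [exact: continuous_measurable_fun|exists M]. Qed.

Lemma bmeas_sin k : bmeas (fun t : measurableTypeR R => sin (k * t) : R).
Proof.
apply: (@continuous_bmeas (fun t => sin (k * t)) 1) => [|t]; last exact: sin_max.
exact: has_deriv_continuous (deriv_sinM k).
Qed.

Lemma bmeas_sin1 : bmeas (sin : measurableTypeR R -> R).
Proof. by apply: (@continuous_bmeas _ 1); [exact: continuous_sin|exact: sin_max]. Qed.

(** The integral against the uniform law is available for functions that are
    nonnegative on the whole line; bounded functions reduce to this by adding a
    constant. *)
Let mean_unif_ge0 g G a M : continuous g -> (forall t, 0 <= g t <= M) ->
  (forall t, has_deriv G t (g t)) -> 0 <= a <= pi ->
  \int[unif]_t (g t * (a <= t)%R%:R) = (G pi - G a) / pi.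
Proof.
move=> cg g0M DG /andP[a0 api].
have cG := has_deriv_continuous DG.
have ba : bmeas (fun t : measurableTypeR R => (a <= t)%R%:R : R) by exact: bmeas_le.
have bg : bmeas (g : measurableTypeR R -> R).
  by apply: (@continuous_bmeas _ M) => // t; have /andP[g0 gM] := g0M t; rewrite ger0_norm.
have [mga _] := bmeasM bg ba.
rewrite /Rintegral /unif integral_uniform/=; last 2 first.
- exact/measurable_EFinP.
- by move=> t; rewrite lee_fin mulr_ge0//; have /andP[] := g0M t.
have -> : (\int[lebesgue_measure]_(t in `[0%R, pi]) (g t * (a <= t)%R%:R)%:E =
    \int[lebesgue_measure]_(t in `[a, pi]) (g t)%:E)%E.
  rewrite [LHS]integral_mkcond [RHS]integral_mkcond; apply: eq_integral => t _.
  rewrite !patchE !mem_setE !in_itv/=; case: (leP a t) => at_/=.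
    by rewrite (le_trans a0 at_)/= mulr1.
  by rewrite mulr0; case: ifP.
rewrite subr0; move: api; rewrite le_eqVlt => /predU1P[->|api].
  by rewrite set_itv1 integral_set1 mule0 subrr mul0r.
rewrite (@continuous_FTC2 _ g G)//.
- by rewrite /= mulrC.
- exact: continuous_subspaceT.
- split => [x _||].
  + by have [] := DG x.
  + by apply: cvg_at_right_filter; exact: cG.
  + by apply: cvg_at_left_filter; exact: cG.
- by move=> x _; rewrite derive1E; have [_ ->] := DG x.
Qed.

Lemma mean_unif g G a M : continuous g -> (forall t, `|g t| <= M) ->
  (forall t, has_deriv G t (g t)) -> 0 <= a <= pi ->
  \int[unif]_t (g t * (a <= t)%R%:R) = (G pi - G a) / pi.
Proof.
move=> cg gM DG api.
have M0 : 0 <= M by exact: le_trans (gM 0).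
have ba : bmeas (fun t : measurableTypeR R => (a <= t)%R%:R : R) by exact: bmeas_le.
have bg := continuous_bmeas cg gM.
have H1 : \int[unif]_t ((g t + M) * (a <= t)%R%:R) = ((G pi + M * pi) - (G a + M * a)) / pi.
  apply: (@mean_unif_ge0 (fun t => g t + M) (fun t => G t + M * t) a (M + M)) => //.
  - by move=> t; apply: cvgD; [exact: cg|exact: cvg_cst].
  - by move=> t; have := gM t; rewrite ler_norml; lra.
  - move=> t; apply: derivD => //; rewrite -[X in has_deriv _ _ X]mulr1.
    by apply: derivZ; exact: deriv_id.
have H2 : \int[unif]_t (M * (a <= t)%R%:R) = (M * pi - M * a) / pi.
  apply: (@mean_unif_ge0 (fun=> M) (fun t => M * t) a M) => //.
  - by move=> t; exact: cvg_cst.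
  - by move=> t; rewrite M0 lexx.
  - move=> t; rewrite -[X in has_deriv _ _ X]mulr1.
    by apply: derivZ; exact: deriv_id.
have -> : \int[unif]_t (g t * (a <= t)%R%:R) =
    \int[unif]_t ((g t + M) * (a <= t)%R%:R) - \int[unif]_t (M * (a <= t)%R%:R).
  rewrite -meanB; first by apply: eq_Rintegral => t _; ring.
    by apply: bmeasM => //; apply: bmeasD => //; exact: bmeas_cst.
  by apply: bmeasM => //; exact: bmeas_cst.
by rewrite H1 H2; ring.
Qed.

Lemma unif_support : {ae unif, forall t, 0 <= t <= pi}.
Proof.
have mI : measurable (`[0, pi]%classic : set (measurableTypeR R)) by [].
exists (~` `[0, pi]%classic); split; first exact: measurableC.
  have := @probability_setC _ _ _ unif _ mI.
  rewrite [X in (_ - X)%E](_ : _ = 1%E) ?subee//.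
  exact: (@integral_uniform_pdf1 R 0 pi `[0, pi]%classic (pi_gt0 R)).
by move=> t /= h; rewrite in_itv/=.
Qed.

Lemma mean_unif_eq (f g : measurableTypeR R -> R) : bmeas f -> bmeas g ->
  (forall t, 0 <= t <= pi -> f t = g t) -> \int[unif]_t f t = \int[unif]_t g t.
Proof.
move=> [mf _] [mg _] fg; congr fine; apply: ae_eq_integral => //.
- exact/measurable_EFinP.
- exact/measurable_EFinP.
- apply: (@filterS _ _ (ae_filter_ringOfSetsType unif) _ _ _ unif_support) => t.
  by move=> /fg ->.
Qed.

Lemma unif_measure (A : set (measurableTypeR R)) (f : measurableTypeR R -> R) :
  measurable A -> bmeas f ->
  (forall t, 0 <= t <= pi -> f t = (t \in A)%:R) ->
  unif A = (\int[unif]_t f t)%:E.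
Proof.
move=> mA bf fA; rewrite -[LHS]fineK ?fin_num_measure// -mean_indic//; congr EFin.
apply: mean_unif_eq => //; first exact: bmeas_indic.
by move=> t /fA ->; rewrite indicE.
Qed.

Lemma mean_unif0 g G M : continuous g -> (forall t, `|g t| <= M) ->
  (forall t, has_deriv G t (g t)) ->
  \int[unif]_t g t = (G pi - G 0) / pi.
Proof.
move=> cg gM DG; rewrite -(mean_unif cg gM DG); last by rewrite lexx pi_ge0.
have bg := continuous_bmeas cg gM.
have b0 : bmeas (fun t : measurableTypeR R => g t * (0 <= t)%R%:R : R).
  by apply: bmeasM => //; exact: bmeas_le.
by apply: mean_unif_eq => // t /andP[-> _]; rewrite mulr1.
Qed.

Lemma mean_unif_indic a : 0 <= a <= pi -> \int[unif]_t (a <= t)%R%:R = (pi - a) / pi.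
Proof.
move=> api.
rewrite -(@mean_unif (fun=> 1) (fun t => t) a 1) ?normr1//.
- by apply: eq_Rintegral => t _; rewrite mul1r.
- by move=> t; exact: cvg_cst.
- exact: deriv_id.
Qed.

Lemma mean_unif_sin a : 0 <= a <= pi ->
  \int[unif]_t (sin t * (a <= t)%R%:R) = (1 + cos a) / pi.
Proof.
move=> api; rewrite (@mean_unif _ (fun t => - cos t) a 1)//.
- by rewrite cospi; ring.
- exact: continuous_sin.
- exact: sin_max.
- move=> t; rewrite /has_deriv -[X in is_derive _ _ _ X]opprK.
  exact: is_deriveN.
Qed.

Lemma mean_unif_sin2 : \int[unif]_t (sin t ^+ 2) = 1 / 2.
Proof.
rewrite (@mean_unif0 _ (fun t => 2^-1 * t - 4^-1 * sin (2 * t)) 1).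
- rewrite !mulr0 sin0 mulr0 !subr0 mulr_natl sin2pi mulr0 subr0 mulfK ?mul1r//.
  by rewrite lt0r_neq0// pi_gt0.
- move=> t; apply: (@cvg_comp _ _ _ sin (fun y : R => y ^+ 2)).
    exact: continuous_sin.
  exact: exprn_continuous.
- by move=> t; rewrite normrX expr_le1// sin_max.
- move=> t; apply: (deriv_eq (a := 2^-1 * 1 - 4^-1 * (2 * cos (2 * t)))).
    apply: derivB; apply: derivZ; first exact: deriv_id.
    exact: deriv_sinM.
  by rewrite (mulr_natl t 2) cos_mulr2n sin2cos2; field.
Qed.

(** Orthogonality of the sines on [0, pi]. *)
Lemma mean_unif_sinM n : (2 <= n)%N -> \int[unif]_t (sin (n%:R * t) * sin t) = 0.
Proof.
move=> n2.
pose p := n.+1%:R : R; pose m := n.-1%:R : R.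
have n0 : (0 < n)%N by exact: leq_trans n2.
have p0 : p != 0 by rewrite pnatr_eq0.
have m0 : m != 0 by rewrite pnatr_eq0; case: n n2 {n0 p p0 m} => [|[]].
have En t : n%:R * t = m * t + t by rewrite /m -[n in LHS]prednK// -natr1; ring.
have Ep t : p * t = n%:R * t + t by rewrite /p -natr1; ring.
have Em t : m * t = n%:R * t - t by rewrite En; ring.
rewrite (@mean_unif0 _ (fun t => (2 * m)^-1 * sin (m * t) - (2 * p)^-1 * sin (p * t)) 1).
- by rewrite /m /p !sin_natpi !mulr0 sin0 !mulr0 !subrr mul0r.
- move=> t; apply: cvgM; last exact: continuous_sin.
  apply: (@cvg_comp _ _ _ (fun t => n%:R * t) sin); last exact: continuous_sin.
  by apply: cvgM; [exact: cvg_cst|exact: cvg_id].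
- by move=> t; rewrite normrM -[leRHS]mulr1 ler_pM// sin_max.
- move=> t; apply: (deriv_eq (a := (2 * m)^-1 * (m * cos (m * t)) - (2 * p)^-1 * (p * cos (p * t)))).
    by apply: derivB; apply: derivZ; exact: deriv_sinM.
  rewrite (Ep t) (Em t) (cosD (n%:R * t) t) cosB; move: p m p0 m0 {En Ep Em} => p m p0 m0.
  by field; rewrite p0 m0.
Qed.

(** The fundamental theorem of calculus for cos (n t); it turns moments into
    integrals of distribution functions. *)
Lemma mean_unif_sinn n a : 0 <= a <= pi ->
  n%:R * pi * \int[unif]_t (sin (n%:R * t) * (a <= t)%R%:R) = cos (n%:R * a) - cos (n%:R * pi).
Proof.
move=> api; case: n => [|n]; first by rewrite !mul0r cos0 subrr.
have n0 : n.+1%:R != 0 :> R by rewrite pnatr_eq0.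
have pi0 : pi != 0 :> R by rewrite lt0r_neq0// pi_gt0.
rewrite (@mean_unif _ (fun t => - n.+1%:R^-1 * cos (n.+1%:R * t)) a 1)//.
- move: (cos (_ * a)) (cos (_ * pi)) => A B.
  by move: n.+1%:R n0 (pi : R) pi0 {api} => k k0 p p0; field; rewrite k0 p0.
- move=> t; apply: (@cvg_comp _ _ _ (fun t => n.+1%:R * t) sin); last exact: continuous_sin.
  by apply: cvgM; [exact: cvg_cst|exact: cvg_id].
- by move=> t; exact: sin_max.
- move=> t; apply: (deriv_eq (a := - n.+1%:R^-1 * (- (n.+1%:R * sin (n.+1%:R * t))))).
    by apply: derivZ; exact: deriv_cosM.
  by rewrite mulrNN mulrA mulVf// mul1r.
Qed.

End angle_mean.

(** * Lower bounds for the entropy *)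

Section entropy_bounds.
Context {R : realType}.
Variables (mu nu : borel_probability R).
Hypotheses (smu : supported_m22 mu) (snu : supported_m22 nu).
Hypotheses (fmu : finite_log_energy mu) (fnu : finite_log_energy nu).
Variable h : R.
Hypothesis hE : free_entropy mu nu = h%:E.
Let TT := (measurableTypeR R * measurableTypeR R)%type.

Let hcvg : sdouble mu nu (reg_kernel (abel_radius n)) @[n --> \oo] --> h.
Proof.
have [h' h'E] := free_entropy_limit smu snu fmu fnu.
by move: h'E; rewrite hE => -[->].
Qed.

(** For fixed n the partial sum is continuous in r, and the bound for r < 1
    passes to the limit. *)
Lemma entropy_ge_moments n :
  \sum_(i < n) 2 / i.+1%:R * moment mu nu i.+1 ^+ 2 <= h.
Proof.
pose u k := \sum_(i < n) 2 * (abel_radius k ^+ i.+1 / i.+1%:R) * moment mu nu i.+1 ^+ 2 : R.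
have cu : u k @[k --> \oo] --> \sum_(i < n) 2 / i.+1%:R * moment mu nu i.+1 ^+ 2.
  rewrite /u; apply: cvg_big => [|i _]; first exact: add_continuous.
  apply: cvgM; last exact: cvg_cst.
  have -> : 2 / i.+1%:R = 2 * (1 ^+ i.+1 / i.+1%:R) :> R by rewrite expr1n mul1r.
  apply: cvgM; first exact: cvg_cst.
  apply: cvgM; last exact: cvg_cst.
  apply: (@cvg_comp _ _ _ (@abel_radius R) (fun x : R => x ^+ i.+1)).
    exact: cvg_radius.
  exact: exprn_continuous.
apply: (ler_cvg_to cu hcvg); apply: nearW => k.
exact/sdouble_reg_kernel_ge/radius01.
Qed.

Lemma entropy_first_moment : (forall n, (2 <= n)%N -> moment mu nu n = 0) ->
  h = 2 * moment mu nu 1 ^+ 2.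
Proof.
move=> m0.
apply: (cvg_unique _ hcvg) => //.
rewrite [X in X @ _](_ : _ = fun n => 2 * abel_radius n * moment mu nu 1 ^+ 2); last first.
  by apply/funext => n; apply: sdouble_reg_kernel_first => //; exact: radius01.
apply: cvgM; last exact: cvg_cst.
rewrite -[X in _ --> X]mulr1; apply: cvgM; first exact: cvg_cst.
exact: cvg_radius.
Qed.

Let amax (z : TT) : R := Num.max (angle z.1) (angle z.2).

Let measurable_amax : measurable_fun setT amax.
Proof. by apply: measurable_maxr; [exact: measurable_angle1|exact: measurable_angle2]. Qed.

Let amax_itv z : 0 <= amax z <= pi.
Proof.
have /andP[a0 a1] := angle_itv z.1; have /andP[b0 b1] := angle_itv z.2.
by rewrite /amax le_max a0/= ge_max a1 b1.
Qed.

Let bmeas_amax : bmeas amax.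
Proof.
split=> //; exists pi => z; have /andP[a0 a1] := amax_itv z.
by rewrite ger0_norm.
Qed.

(** The Fejer weights are at most 1 / i ^ 2 <= 1 / i, so the form of the Fejer
    sums is at most the entropy. Their limit at a + b and |a - b| adds up to
    - pi max(a, b) plus functions of a alone and of b alone. *)
Lemma entropy_ge_max : sdouble mu nu (fun z => pi * (pi - amax z)) <= h.
Proof.
rewrite -[leRHS]addr0; apply/ler_addgt0Pr => e e0.
have [n Hn] := @fejer_sum_cvg R (e / 8) (divr_gt0 e0 (ltr0n _ 8)).
pose w (i : 'I_n) : R := (n.+1%:R - i.+1%:R) / n.+1%:R / i.+1%:R ^+ 2.
pose S (z : TT) := cos_sum w (angle z.1 + angle z.2) + cos_sum w (angle z.1 - angle z.2).
have mD := measurable_funD (@measurable_angle1 R) (@measurable_angle2 R).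
have mB := measurable_funB (@measurable_angle1 R) (@measurable_angle2 R).
have bS : bmeas S by apply: bmeasD; exact: bmeas_cos_sum.
have S_h : sdouble mu nu S <= h.
  rewrite sdouble_cos_sum; apply: le_trans (entropy_ge_moments n).
  apply: ler_sum => i _; rewrite ler_wpM2r ?sqr_ge0// ler_wpM2l//.
  rewrite /w; have n0 : 0 < n.+1%:R :> R by rewrite ltr0n.
  have i0 : 0 < i.+1%:R :> R by rewrite ltr0n.
  have i1 : 1 <= i.+1%:R :> R by rewrite ler1n.
  have ni : (i.+1%:R : R) <= n.+1%:R by rewrite ler_nat ltnW// ltnS ltn_ord.
  rewrite -[leRHS]mul1r; apply: ler_pM.
  - by rewrite divr_ge0 ?subr_ge0// ltW.
  - by rewrite invr_ge0 exprn_ge0// ltW.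
  - by rewrite ler_pdivrMr// mul1r gerBl ltW.
  - by rewrite lef_pV2 ?posrE ?exprn_gt0// expr2 ler_peMl// ltW.
(* The one-variable part, split evenly between the two coordinates. *)
pose half (x : measurableTypeR R) : R :=
  (angle x ^+ 2 + pi ^+ 2 / 2 + 2 * fejer_sum n pi) / 2 - pi ^+ 2 / 2.
have bhalf : bmeas half.
  have ba := @bmeas_angle R.
  have bc c : bmeas (fun x : measurableTypeR R => c : R) by exact: bmeas_cst.
  apply: bmeasB => //; apply: bmeasM => //; apply: bmeasD => //; apply: bmeasD => //.
  exact: bmeasM.
pose K (z : TT) := pi * (pi - amax z).
have bK : bmeas K.
  by apply: bmeasZ; apply: bmeasB => //; exact: bmeas_cst.
have bh1 : bmeas (fun z : TT => half z.1) by exact: bmeas_comp.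
have bh2 : bmeas (fun z : TT => half z.2) by exact: bmeas_comp.
have E : sdouble mu nu (fun z => K z + (half z.1 + half z.2)) = sdouble mu nu K.
  rewrite sdoubleD//; last exact: bmeasD.
  by rewrite sdoubleD// sdouble1// sdouble2// !addr0.
have close z : `|S z - (K z + (half z.1 + half z.2))| <= e / 4.
  have /andP[a0 a1] := angle_itv z.1; have /andP[b0 b1] := angle_itv z.2.
  (* [fejer_sum_cvg] needs an argument in [0, 2 pi], and cosines are even. *)
  rewrite /S /K /half /amax -[cos_sum _ (_ - _)]cos_sum_even.
  move: (angle z.1) (angle z.2) a0 a1 b0 b1 => a b a0 a1 b0 b1.
  have mx : Num.max a b = (a + b + `|a - b|) / 2 by rewrite maxr_absE.
  have ab : `|a - b| ^+ 2 = (a - b) ^+ 2 by rewrite real_normK ?num_real.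
  have h1 := Hn (a + b); have h2 := Hn `|a - b|.
  have {}h1 : `|fejer_sum n (a + b) - fejer_sum n pi - (a + b - pi) ^+ 2 / 4| <= e / 8.
    by apply: h1; lra.
  have {}h2 : `|fejer_sum n `|a - b| - fejer_sum n pi - (`|a - b| - pi) ^+ 2 / 4| <= e / 8.
    apply: h2; rewrite normr_ge0/= ler_norml; have := @pi_ge0 R; lra.
  have -> : e / 4 = e / 8 + e / 8 by field.
  apply: le_trans (lerD h1 h2); apply: le_trans (ler_normD _ _).
  rewrite le_eqVlt; apply/orP; left; apply/eqP; congr (`| _ |).
  have Sw t : cos_sum w t = fejer_sum n t by [].
  rewrite !Sw mx.
  move: (fejer_sum n (a + b)) (fejer_sum n pi) (fejer_sum n `|a - b|) => s1 s2 s3.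
  move: (`|a - b| : R) ab => d ab.
  rewrite [X in _ = _ + (_ - X / 4)]sqrrB ab; lra.
have bk := bmeasD bK (bmeasD bh1 bh2).
have := sdouble_close mu nu bS bk close.
rewrite E ler_norml; rewrite -/K; move: S_h.
move: (sdouble mu nu S) (sdouble mu nu K) => x y; lra.
Qed.

Definition cdf_gap (t : measurableTypeR R) : R := smean mu nu (fun x => (angle x <= t)%R%:R).

(** Fubini, for each of the four product measures. *)
Lemma sdouble_swap (k : TT * measurableTypeR R -> R) : bmeas k ->
  \int[@unif R]_t (sdouble mu nu (fun z => k (z, t))) =
  sdouble mu nu (fun z => \int[@unif R]_t k (z, t)).
Proof.
move=> bk; rewrite /sdouble.
have b (m m' : borel_probability R) : bmeas (fun t => \int[(m \x m')%E]_z k (z, t)).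
  exact: (bmeas_mean1 (m \x m')%E unif bk).
rewrite meanD//; last by apply: bmeasB => //; exact: bmeasB.
rewrite meanB//; last exact: bmeasB.
rewrite meanB//.
by rewrite !(mean_swap _ _ bk).
Qed.

Lemma bmeas_angle_le t : bmeas (fun x : measurableTypeR R => (angle x <= t)%R%:R : R).
Proof. by apply: bmeas_le => //; exact: measurable_angle. Qed.

Lemma bmeas_cdf_gap : bmeas cdf_gap.
Proof.
have b : bmeas (fun w : TT => (angle w.1 <= w.2)%R%:R : R).
  by apply: bmeas_le => //; exact: measurable_angle1.
apply: bmeasB; first exact: (bmeas_mean1 mu unif b).
exact: (bmeas_mean1 nu unif b).
Qed.

(** The product of the indicators of {a <= t} and {b <= t} is the indicator of
    {max(a, b) <= t}, whose integral over t is (pi - max(a, b)) / pi. *)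
Lemma mean_cdf_gap2 :
  pi ^+ 2 * \int[@unif R]_t (cdf_gap t ^+ 2) = sdouble mu nu (fun z => pi * (pi - amax z)).
Proof.
pose k (w : TT * measurableTypeR R) : R := (amax w.1 <= w.2)%R%:R.
have bk : bmeas k.
  by apply: bmeas_le => //; exact: (measurableT_comp measurable_amax).
have -> : \int[@unif R]_t (cdf_gap t ^+ 2) = \int[@unif R]_t (sdouble mu nu (fun z => k (z, t))).
  apply: eq_Rintegral => t _; rewrite expr2 -sdoubleM; [|exact: bmeas_angle_le..].
  congr sdouble; apply/funext => z; rewrite /k /= /amax ge_max.
  by case: (_ <= _); case: (_ <= _); rewrite ?mulr1 ?mulr0.
have pi0 : pi != 0 :> R by rewrite lt0r_neq0// pi_gt0.
rewrite sdouble_swap// -sdoubleZ.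
  congr sdouble; apply/funext => z; rewrite /k/= mean_unif_indic//.
  by move: (amax z) (pi : R) pi0 => a p p0; field.
exact: (bmeas_mean2 (mu \x nu)%E unif bk).
Qed.

Lemma entropy_ge_cdf_gap2 : pi ^+ 2 * \int[@unif R]_t (cdf_gap t ^+ 2) <= h.
Proof. by rewrite mean_cdf_gap2 entropy_ge_max. Qed.

End entropy_bounds.

(** * Quantile functions *)

Section quantile.
Context {R : realType}.
Variable mu : borel_probability R.
Hypothesis smu : supported_m22 mu.
Implicit Types x t : R.

Let F x : R := fine (mu `]-oo, x[%classic).

Let FE x : (F x)%:E = mu `]-oo, x[%classic.
Proof. by rewrite fineK// fin_num_measure. Qed.

Let F_nondecr x y : x <= y -> F x <= F y.
Proof.
move=> xy; rewrite -lee_fin !FE le_measure ?inE// => z /=.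
by rewrite !in_itv/= => /lt_le_trans; apply.
Qed.

Let F_ge0 x : 0 <= F x.
Proof. by rewrite -lee_fin FE. Qed.

Let outside0 : mu (~` `[(- 2)%R, 2%R]%classic) = 0%:E.
Proof.
have mI : measurable (`[(- 2)%R, 2%R]%classic : set (measurableTypeR R)) by [].
by rewrite probability_setC// smu subee.
Qed.

Let F_left x : x <= - 2 -> F x = 0.
Proof.
move=> x2; apply/eqP; rewrite eq_le F_ge0 andbT -lee_fin FE.
apply: (@le_trans _ _ (mu (~` `[(- 2)%R, 2%R]%classic))); last by rewrite outside0.
apply: le_measure; rewrite ?inE//; first exact: measurableC.
by move=> z /=; rewrite !in_itv/= => zx /andP[]; rewrite leNgt (lt_le_trans zx).
Qed.

Let F_right x : 2 < x -> mu `[x, +oo[%classic = 0%E.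
Proof.
move=> x2; apply/eqP; rewrite eq_le measure_ge0 andbT.
apply: (@le_trans _ _ (mu (~` `[(- 2)%R, 2%R]%classic))); last by rewrite outside0.
apply: le_measure; rewrite ?inE//; first exact: measurableC.
by move=> z /=; rewrite !in_itv/= andbT => xz /andP[_]; rewrite leNgt (lt_le_trans x2).
Qed.

(** Left continuity of F, as continuity of mu along increasing unions. *)
Let F_left_cont x (v : R) : (forall y, y < x -> F y <= v) -> F x <= v.
Proof.
move=> Fv.
pose A (k : nat) : set (measurableTypeR R) := `]-oo, (x - k.+1%:R^-1)%R[%classic.
have AU : \bigcup_k A k = `]-oo, x[%classic.
  rewrite eqEsubset; split => [y [k _]|y]/=; rewrite /A/= !in_itv/=.
    by move=> /lt_trans; apply; rewrite gtrBl invr_gt0 ltr0n.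
  move=> yx; have xy0 : 0 < x - y by rewrite subr_gt0.
  exists (Num.truncn (x - y)^-1) => //=; rewrite in_itv/= ltrBrDl -ltrBrDr.
  by rewrite invf_plt ?posrE// truncnS_gt.
have cv : mu (A k) @[k --> \oo] --> mu (\bigcup_k A k).
  have mA k : measurable (A k) by rewrite /A; exact: measurable_itv.
  apply: nondecreasing_cvg_mu => //; first exact: bigcupT_measurable.
  move=> m n mn; apply/subsetPset => y; rewrite /A/= !in_itv/= => /lt_le_trans; apply.
  by rewrite lerD2l lerN2 lef_pV2 ?posrE// ler_nat ltnS.
rewrite -lee_fin FE -AU -(cvg_lim _ cv)//; apply: lime_le.
  by apply/cvg_ex; eexists; exact: cv.
by apply: nearW => k; rewrite -FE lee_fin Fv// gtrBl invr_gt0 ltr0n.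
Qed.

Let level t : R := Num.max 0 (t / pi).

(** The quantile function of mu, driven by an angle t uniform on [0, pi] instead
    of a level uniform on [0, 1]. The supremum, as opposed to the infimum of the
    upper levels, matches the open rays of F and the closed rays of
    [distribution_quantile]. *)
Definition quantile (t : measurableTypeR R) : measurableTypeR R :=
  sup [set x | x <= 2 /\ F x <= level t].

Let has_sup_quantile t : has_sup [set x | x <= 2 /\ F x <= level t].
Proof.
split; last by exists 2 => x [].
by exists (- 2) => /=; split; [lra|rewrite F_left// le_max lexx].
Qed.

Lemma quantile_itv t : - 2 <= quantile t <= 2.
Proof.
apply/andP; split; last first.
  by apply: ge_sup; [have [] := has_sup_quantile t|move=> x []].
apply: ub_le_sup; first by have [] := has_sup_quantile t.
by split; [lra|rewrite F_left// le_max lexx].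
Qed.

(** Quantile and distribution function are adjoint. This determines the law of
    the quantile and its monotonicity. *)
Let quantile_galois x t : x <= 2 -> (x <= quantile t) = (F x <= level t).
Proof.
move=> x2; apply/idP/idP => [xq|Fx]; last first.
  by apply: ub_le_sup; [have [] := has_sup_quantile t|split].
apply: F_left_cont => y yx.
have [z [_ Fz] yz] := @sup_gt R [set x | x <= 2 /\ F x <= level t] y
  (proj1 (has_sup_quantile t)) (lt_le_trans yx xq).
exact: le_trans (F_nondecr (ltW yz)) Fz.
Qed.

Lemma quantile_nondecr t u : t <= u -> quantile t <= quantile u.
Proof.
move=> tu; have /andP[_ q2] := quantile_itv t.
rewrite quantile_galois//.
have : F (quantile t) <= level t by rewrite -quantile_galois.
move=> /le_trans; apply; rewrite /level ge_max !le_max lexx/=.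
by rewrite ler_wpM2r ?orbT// invr_ge0 pi_ge0.
Qed.

Lemma measurable_quantile : measurable_fun setT quantile.
Proof. by apply: nondecreasing_measurable => // t u; exact: quantile_nondecr. Qed.

HB.instance Definition _ := isMeasurableFun.Build _ _ _ _ quantile measurable_quantile.

Lemma distribution_quantile (A : set (measurableTypeR R)) : measurable A ->
  distribution unif quantile A = mu A.
Proof.
move=> mA.
refine (@measure_unique _ R (measurableTypeR R) (@RGenCInfty.G R)
  (fun k => `[(- k%:R)%R, +oo[%classic) _ _ _ _
  (distribution unif quantile) mu _ _ A mA).
- exact: RGenCInfty.measurableE.
- move=> _ _ [x ->] [y ->]; exists (Num.max x y).
  apply/seteqP; split => z /=; rewrite !in_itv/= !andbT ge_max.
    by move=> [-> ->].
  by move=> /andP[-> ->].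
- by move=> k; exists (- k%:R).
- rewrite -subTset => x _; exists (Num.truncn (- x)).+1 => //=.
  by rewrite in_itv/= andbT lerNl ltW// truncnS_gt.
- move=> _ [x ->]; rewrite /distribution /pushforward/=.
  have [x2|x2] := leP x 2; last first.
    rewrite [RHS]F_right// [X in unif X](_ : _ = set0) ?measure0//.
    rewrite -subset0 => t /=; rewrite in_itv/= andbT => xq.
    have /andP[_] := quantile_itv t; by rewrite leNgt (lt_le_trans x2 xq).
  have mq : measurable (quantile @^-1` `[x, +oo[).
    by rewrite -[X in measurable X]setTI; exact: measurable_quantile.
  have F1 : F x <= 1 by rewrite -lee_fin FE probability_le1.
  have pi0 : pi != 0 :> R by rewrite lt0r_neq0// pi_gt0.
  have -> : mu `[x, +oo[%classic = (1 - F x)%:E.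
    rewrite -setCitvl probability_setC//.
    by rewrite -FE.
  rewrite (@unif_measure _ _ (fun t => (pi * F x <= t)%R%:R))//.
  + rewrite mean_unif_indic.
      by congr EFin; move: (pi : R) pi0 => p p0; field.
    by rewrite mulr_ge0 ?pi_ge0 ?F_ge0//= ler_piMr ?pi_ge0.
  + exact: bmeas_le.
  + move=> t /andP[t0 _].
    have -> : (t \in quantile @^-1` `[x, +oo[%classic) = (x <= quantile t)%R.
      by apply/idP/idP; rewrite inE/= in_itv/= andbT.
    by rewrite quantile_galois// /level max_r ?divr_ge0 ?pi_ge0// ler_pdivlMr ?pi_gt0// mulrC.
- by move=> k; rewrite (le_lt_trans (probability_le1 _ _))// ltry.
Qed.

Lemma mean_quantile (f : measurableTypeR R -> R) : bmeas f ->
  \int[unif]_t f (quantile t) = \int[mu]_x f x.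
Proof.
by move=> bf; exact: mean_pushforward measurable_quantile bf distribution_quantile.
Qed.

End quantile.

(** * Bounds for the Wasserstein distance *)

Section transport.
Context {R : realType}.
Let TT := (measurableTypeR R * measurableTypeR R)%type.

(** The distance is the integral of 2 sin t over the interval from a to b. *)
Lemma dist_cos_unif (a b : R) : 0 <= a <= pi -> 0 <= b <= pi ->
  `|2 * cos a - 2 * cos b| =
  2 * pi * \int[unif]_t (sin t * `|(a <= t)%R%:R - (b <= t)%R%:R|).
Proof.
wlog ab : a b / a <= b => [H ha hb|ha hb].
  have [ab|/ltW ba] := leP a b; first exact: H.
  rewrite distrC H//; congr (_ * _); apply: eq_Rintegral => t _.
  by rewrite distrC.
have bsin := @bmeas_sin1 R.
have bi c : bmeas (fun t : measurableTypeR R => sin t * (c <= t)%R%:R : R).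
  by apply: bmeasM => //; exact: bmeas_le.
have -> : \int[unif]_t (sin t * `|(a <= t)%R%:R - (b <= t)%R%:R|) =
    \int[unif]_t (sin t * (a <= t)%R%:R) - \int[unif]_t (sin t * (b <= t)%R%:R).
  rewrite -meanB//; apply: eq_Rintegral => t _; rewrite -mulrBr; congr (_ * _).
  have [bt|tb] := leP b t; first by rewrite (le_trans ab bt) subrr normr0.
  by case: (a <= t)%R; rewrite subr0 ?normr1 ?normr0.
rewrite !mean_unif_sin//.
have cab : cos b <= cos a.
  move: ab; rewrite le_eqVlt => /predU1P[->//|ab].
  by rewrite ltW// ltr_cos// in_itv/=.
rewrite -mulrBr normrM ger0_norm// ger0_norm ?subr_ge0//.
have pi0 : pi != 0 :> R by rewrite lt0r_neq0// pi_gt0.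
by move: (cos a) (cos b) (pi : R) pi0 {ha hb} => c d p p0; field.
Qed.

(** The difference has constant sign. *)
Lemma mean_comonotone d (T : measurableType d) (P : probability T R)
    (f g : T -> R) : bmeas f -> bmeas g ->
  (forall x, f x <= g x) \/ (forall x, g x <= f x) ->
  \int[P]_x `|f x - g x| = `|\int[P]_x f x - \int[P]_x g x|.
Proof.
move=> bf bg; wlog fg : f g bf bg / (forall x, f x <= g x) => [H [fg|gf]|_].
- by apply: H => //; left.
- rewrite distrC -H//; last by left.
  by apply: eq_Rintegral => x _; rewrite distrC.
rewrite -meanB//; transitivity (\int[P]_x (g x - f x)).
  by apply: eq_Rintegral => x _; rewrite distrC ger0_norm// subr_ge0.
rewrite !meanB// distrC ger0_norm// subr_ge0; exact: le_mean.
Qed.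

(** The easy half of Kantorovich duality for the test function 2 cos a, which is
    x on [-2, 2] and 1-Lipschitz on the line. *)
Lemma W1_ge_moment (mu nu : borel_probability R) :
  ((2 * `|moment mu nu 1|)%:E <= W1 mu nu)%E.
Proof.
apply: le_ereal_inf_tmp => _ [p cp <-].
have bc := @bmeas_cos_angle R 1.
have b1 : bmeas (fun z : TT => cos (1%:R * angle z.1)) by exact: bmeas_comp bc measurable_fst.
have b2 : bmeas (fun z : TT => cos (1%:R * angle z.2)) by exact: bmeas_comp bc measurable_snd.
have m1 : \int[mu]_x cos (1%:R * angle x) = \int[p]_z cos (1%:R * angle z.1).
  apply/esym; apply: (@mean_pushforward _ _ _ _ _ p mu fst _ measurable_fst bc) => A mA.
  by have [] := cp A mA.
have m2 : \int[nu]_x cos (1%:R * angle x) = \int[p]_z cos (1%:R * angle z.2).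
  apply/esym; apply: (@mean_pushforward _ _ _ _ _ p nu snd _ measurable_snd bc) => A mA.
  by have [] := cp A mA.
have bB := bmeasB b1 b2.
apply: (@le_trans _ _ (2 * \int[p]_z `|cos (1%:R * angle z.1) - cos (1%:R * angle z.2)|)%:E).
  rewrite lee_fin ler_wpM2l// /moment /smean m1 m2 -meanB//.
  by apply: le_normr_Rintegral => //; exact: bmeas_integrable.
rewrite -meanZ; last exact: bmeas_norm.
rewrite EFin_Rintegral; last by apply: bmeasZ; exact: bmeas_norm.
apply: ge0_le_integral => //.
- by apply/measurable_EFinP; case: (bmeasZ 2 (bmeas_norm bB)).
- by apply/measurable_EFinP; apply: measurableT_comp => //; exact: measurable_funB.
- move=> z _; rewrite lee_fin !mul1r !cos_angle.
  wlog zz : z / z.1 <= z.2 => [H|].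
    have [|/ltW h] := leP z.1 z.2; first exact: H.
    by rewrite distrC [leRHS]distrC (H (z.2, z.1)).
  have c12 := le_clamp zz.
  rewrite distrC [leRHS]distrC ger0_norm ?subr_ge0// ger0_norm ?subr_ge0//.
  exact: clamp_lip.
Qed.

Section upper.
Variables (mu nu : borel_probability R).
Hypotheses (smu : supported_m22 mu) (snu : supported_m22 nu).

Let qq (t : measurableTypeR R) : TT := (quantile mu t, quantile nu t).

Let measurable_qq : measurable_fun setT qq.
Proof. by apply: measurable_fun_pair; exact: measurable_quantile. Qed.

HB.instance Definition _ := isMeasurableFun.Build _ _ _ _ qq measurable_qq.

(** The sets of t with quantile angle at most s are upper sets of the line for
    both measures, hence nested. *)
Let comonotone s :
  (forall t, ((angle (quantile mu t) <= s)%R%:R : R) <= (angle (quantile nu t) <= s)%R%:R) \/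
  (forall t, ((angle (quantile nu t) <= s)%R%:R : R) <= (angle (quantile mu t) <= s)%R%:R).
Proof.
pose A t := (angle (quantile mu t) <= s)%R; pose B t := (angle (quantile nu t) <= s)%R.
have mA t u : t <= u -> A t -> A u.
  by move=> tu; apply: le_trans; apply: angle_nincr; exact: quantile_nondecr.
have mB t u : t <= u -> B t -> B u.
  by move=> tu; apply: le_trans; apply: angle_nincr; exact: quantile_nondecr.
have imp (b c : bool) : (b -> c) -> (b%:R : R) <= c%:R.
  by case: b; case: c => // /(_ isT).
have [[t At Bt]|H] := pselect (exists2 t, A t & ~~ B t).
  right=> u; apply: imp => Bu; apply: (mA t) => //.
  by rewrite leNgt; apply: contra Bt => /ltW /mB; apply.
left=> u; apply: imp => Au; apply: contrapT => /negP Bu.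
by apply: H; exists u.
Qed.

(** The cost of the coupling by quantiles; after Fubini, nestedness turns the
    measure of a symmetric difference into a difference of measures. *)
Lemma W1_le_cdf_gap :
  (W1 mu nu <= (2 * pi * \int[unif]_s (sin s * `|cdf_gap mu nu s|))%:E)%E.
Proof.
pose k (w : measurableTypeR R * measurableTypeR R) : R :=
  sin w.2 * `|(angle (quantile mu w.1) <= w.2)%R%:R - (angle (quantile nu w.1) <= w.2)%R%:R|.
have bsin := @bmeas_sin1 R.
have bang m (sm : supported_m22 m) :
    bmeas (fun w : TT => (angle (quantile m w.1) <= w.2)%R%:R : R).
  apply: (@bmeas_le R _ _ (fun w : TT => angle (quantile m w.1)) snd); last first.
    exact: measurable_snd.
  apply: measurableT_comp; first exact: measurable_angle.
  apply: measurableT_comp; [exact: (measurable_quantile sm)|exact: measurable_fst].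
have bk : bmeas k.
  apply: bmeasM; first exact: (bmeas_comp bsin measurable_snd).
  by apply: bmeas_norm; apply: bmeasB; exact: bang.
have bqang m (sm : supported_m22 m) (s : R) :
    bmeas (fun t : measurableTypeR R => (angle (quantile m t) <= s)%R%:R : R).
  exact: (bmeas_section2 s (bang m sm)).
have E : \int[unif]_t `|quantile mu t - quantile nu t| =
    2 * pi * \int[unif]_s (sin s * `|cdf_gap mu nu s|).
  transitivity (2 * pi * \int[unif]_t (\int[unif]_s k (t, s))).
    rewrite -meanZ; last exact: (bmeas_mean2 unif unif bk).
    apply: eq_Rintegral => t _.
    rewrite [X in `|X - _|](cos_angleK (quantile_itv smu t)).
    rewrite [X in `|_ - X|](cos_angleK (quantile_itv snu t)).
    by rewrite dist_cos_unif ?angle_itv.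
  rewrite (mean_swap unif unif bk); congr (_ * _); apply: eq_Rintegral => s _.
  rewrite /k/= meanZ; last by apply: bmeas_norm; apply: bmeasB; exact: bqang.
  congr (_ * _); rewrite mean_comonotone; [|exact: bqang|exact: bqang|exact: comonotone].
  have bas := @bmeas_angle_le R s.
  by rewrite (mean_quantile smu bas) (mean_quantile snu bas).
rewrite -E; apply: ereal_inf_lbound; exists (distribution unif qq).
  move=> A mA; split.
    by rewrite -(distribution_quantile smu mA).
  by rewrite -(distribution_quantile snu mA).
rewrite ge0_integral_distribution//=.
  rewrite EFin_Rintegral//; apply: bmeas_norm; apply: bmeasB.
    split; first exact: measurable_quantile.
    by exists 2 => t; have := quantile_itv smu t; rewrite ler_norml.
  split; first exact: measurable_quantile.
  by exists 2 => t; have := quantile_itv snu t; rewrite ler_norml.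
apply/measurable_EFinP; apply: measurableT_comp => //; exact: measurable_funB.
Qed.

Lemma W1_ge0 : (0 <= W1 mu nu)%E.
Proof. by apply: le_ereal_inf_tmp => _ [p _ <-]; apply: integral_ge0. Qed.

(** Cauchy-Schwarz: the mean of (|Phi| - 2 J sin) ^ 2 is nonnegative, where J is
    the mean of |Phi| sin and sin ^ 2 has mean 1/2. *)
Lemma W1_sqr_le_cdf_gap2 :
  (W1 mu nu ^+ 2 <= (2 * (pi ^+ 2 * \int[unif]_s (cdf_gap mu nu s ^+ 2)))%:E)%E.
Proof.
pose J := \int[unif]_s (sin s * `|cdf_gap mu nu s|).
have bsin := @bmeas_sin1 R.
have bphi := bmeas_cdf_gap mu nu.
have CS : 2 * J ^+ 2 <= \int[unif]_s (cdf_gap mu nu s ^+ 2).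
  have b1 := bmeasM bphi bphi; have b2 := bmeasM bsin (bmeas_norm bphi).
  have b3 := bmeasM bsin bsin.
  have : 0 <= \int[unif]_s ((cdf_gap mu nu s * cdf_gap mu nu s
      - 4 * J * (sin s * `|cdf_gap mu nu s|)) + 4 * J ^+ 2 * (sin s * sin s)).
    apply: Rintegral_ge0 => s _.
    have -> : cdf_gap mu nu s * cdf_gap mu nu s = `|cdf_gap mu nu s| ^+ 2.
      by rewrite real_normK ?num_real ?expr2.
    rewrite (_ : _ + _ = (`|cdf_gap mu nu s| - 2 * J * sin s) ^+ 2) ?sqr_ge0//.
    by move: `|cdf_gap mu nu s| => y; ring.
  rewrite meanD; [|by apply: bmeasB => //; exact: bmeasZ|exact: bmeasZ].
  rewrite meanB//; last exact: bmeasZ.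
  rewrite !meanZ// -/J.
  have := @mean_unif_sin2 R; rewrite /= => S2.
  have -> : \int[unif]_s (sin s * sin s) = 1 / 2 :> R by rewrite -S2.
  have -> : \int[unif]_s (cdf_gap mu nu s * cdf_gap mu nu s) = \int[unif]_s (cdf_gap mu nu s ^+ 2).
    by [].
  move: (Rintegral _ _ _) => y; lra.
have := W1_le_cdf_gap; have := W1_ge0; rewrite -/J.
case: (W1 mu nu) => [w| |]//=; rewrite !lee_fin => w0 wJ.
have : w * w <= (2 * pi * J) * (2 * pi * J) by apply: ler_pM.
move=> /le_trans; apply.
rewrite (_ : _ * _ = 2 * (pi ^+ 2 * (2 * J ^+ 2))); last by ring.
by rewrite ler_wpM2l// ler_wpM2l// exprn_ge0// pi_ge0.
Qed.

End upper.
End transport.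

(** * The arcsine law is the law of 2 cos t *)

Section arcsine.
Context {R : realType}.
Notation beta := (@arcsine_law R).
Implicit Types (s t x : R).

Lemma measurable_arcsine_densityE (A : set R) :
  measurable_fun A (fun x => (arcsine_density x)%:E).
Proof.
apply: measurable_funTS; apply/measurable_EFinP.
exact: measurable_arcsine_density.
Qed.

(** Away from the endpoints -2 and 2 the density is continuous, with primitive
    - acos (y / 2) / pi. *)
Lemma arcsine_law_itv s t : 0 < t -> t <= s -> s < pi ->
  beta `](2 * cos s)%R, (2 * cos t)%R]%classic = ((s - t) / pi)%:E.
Proof.
move=> t0; rewrite le_eqVlt => /predU1P[<- spi|ts spi].
  by rewrite set_itvoc0 measure0 subrr mul0r.
have s0 : 0 < s by exact: lt_trans ts.
have tpi : t < pi by exact: lt_trans spi.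
have cst : cos s < cos t by rewrite ltr_cos// in_itv/= !ltW.
have c1 : -1 < cos s by rewrite -(@cospi R) ltr_cos// in_itv/= ?lexx ?pi_ge0 ?ltW.
have c2 : cos t < 1 by rewrite -(@cos0 R) ltr_cos// in_itv/= ?lexx ?pi_ge0 ?ltW.
have yint (y : R) : 2 * cos s <= y -> y <= 2 * cos t -> -1 < y / 2 < 1.
  by move=> sy yt; apply/andP; split; lra.
rewrite /arcsine_law setIidl; last first.
  by move=> y /=; rewrite !in_itv/= => /andP[sy yt]; apply/andP; split; lra.
rewrite integral_itv_obnd_cbnd; last exact: measurable_arcsine_densityE.
have dG (y : R) : -1 < y / 2 < 1 ->
    has_deriv (fun z => - pi^-1 * acos (z / 2)) y (arcsine_density y).
  move=> y1.
  apply: (deriv_eq (a := - pi^-1 * (- (Num.sqrt (1 - (y / 2) ^+ 2))^-1 * (2^-1 * 1)))).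
    apply: derivZ.
    rewrite [X in has_deriv X _ _](_ : _ = fun z => acos (2^-1 * z)); last first.
      by apply/funext => z; rewrite mulrC.
    rewrite [y / 2]mulrC in y1 *.
    exact (@deriv_comp _ (@acos R) (fun z => 2^-1 * z) y _ _
      (is_derive1_acos y1) (derivZ 2^-1 (deriv_id y))).
  rewrite /arcsine_density.
  have -> : 4 - y ^+ 2 = 2 ^+ 2 * (1 - (y / 2) ^+ 2) by field.
  rewrite sqrtrM ?sqr_ge0// sqrtr_sqr ger0_norm// !invfM.
  by rewrite mulr1 !mulNr mulrN opprK; congr (_ * _); rewrite mulrC.
rewrite (@continuous_FTC2 _ _ (fun z => - pi^-1 * acos (z / 2))).
- rewrite -EFinB; congr EFin.
  have K (u : R) : 0 <= u <= pi -> acos (2 * cos u / 2) = u.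
    by move=> u0; rewrite mulrAC divff// mul1r cosK.
  rewrite (K t) ?(ltW t0) ?(ltW tpi)// (K s) ?(ltW s0) ?(ltW spi)//; ring.
- lra.
- apply: continuous_in_subspaceT => y; rewrite inE/= in_itv/= => /andP[sy yt].
  rewrite /arcsine_density; apply: cvgV.
    rewrite mulf_neq0 ?lt0r_neq0 ?pi_gt0// sqrtr_gt0.
    have := yint y sy yt; nra.
  apply: cvgM; first exact: cvg_cst.
  apply: (@continuous_comp _ _ _ (fun y : R => (4 - y ^+ 2)%R) Num.sqrt).
    by apply: cvgB; [exact: cvg_cst|exact: exprn_continuous].
  exact: sqrt_continuous.
- have cG (y : R) : 2 * cos s <= y -> y <= 2 * cos t ->
      {for y, continuous (fun z : R => - pi^-1 * acos (z / 2))}.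
    move=> sy yt; apply/differentiable_continuous/derivable1_diffP.
    by have [] := dG y (yint y sy yt).
  split => [y||].
  + by rewrite in_itv/= => /andP[sy yt]; have [] := dG y (yint y (ltW sy) (ltW yt)).
  + by apply: cvg_at_right_filter; apply: cG; lra.
  + by apply: cvg_at_left_filter; apply: cG; lra.
- move=> y; rewrite in_itv/= => /andP[sy yt].
  by rewrite derive1E; have [_ ->] := dG y (yint y (ltW sy) (ltW yt)).
Qed.

Let arcsine_law_split (i : interval R) (j : interval R) :
  [set` i] `&` `[(-2)%R, 2%R]%classic = [set` j] ->
  beta [set` i] = (\int[lebesgue_measure]_(x in [set` j]) (arcsine_density x)%:E)%E.
Proof. by move=> ij; rewrite /arcsine_law ij. Qed.

Let harm_cvg (a b : R) : (a - b / k.+2%:R) @[k --> \oo] --> a.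
Proof.
rewrite -[X in _ --> X]subr0; apply: cvgB; first exact: cvg_cst.
rewrite -(mulr0 b); apply: cvgM; first exact: cvg_cst.
by have := @cvg_harmonic R; rewrite -(cvg_shiftS (@harmonic R)); apply.
Qed.

Let harm_lt (a e : R) : 0 < e -> 0 < a -> exists k, a / k.+2%:R < e.
Proof.
move=> e0 a0; exists (Num.truncn (a / e)).
rewrite ltr_pdivrMr ?ltr0n// mulrC -ltr_pdivrMr//.
by rewrite (lt_le_trans (truncnS_gt _))// ler_nat.
Qed.

Let harm_anti (a : R) m n : 0 <= a -> (m <= n)%N -> a / n.+2%:R <= a / m.+2%:R.
Proof. by move=> a0 mn; rewrite ler_wpM2l// lef_pV2 ?posrE ?ltr0n// ler_nat !ltnS. Qed.

Let cos_le s t : 0 <= s -> s <= t -> t <= pi -> cos t <= cos s.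
Proof.
move=> s0; rewrite le_eqVlt => /predU1P[->//|st tpi].
rewrite ltW// ltr_cos// in_itv/= ?s0 ?tpi ?andbT ?(le_trans _ tpi) ?(ltW st)//.
exact: le_trans s0 (ltW st).
Qed.

Let cos_lt s t : 0 <= s -> s < t -> t <= pi -> cos t < cos s.
Proof.
move=> s0 st tpi; rewrite ltr_cos// in_itv/= ?s0 ?tpi ?andbT ?(le_trans _ tpi) ?(ltW st)//.
exact: le_trans s0 (ltW st).
Qed.

(** The density is unbounded at 2, so the interval up to 2 is exhausted by the
    intervals of [arcsine_law_itv]. *)
Lemma arcsine_law_ray s : 0 < s < pi ->
  beta `](2 * cos s)%R, +oo[%classic = (s / pi)%:E.
Proof.
move=> /andP[s0 spi].
have cs1 : cos s < 1 by rewrite -(@cos0 R) cos_lt// ltW.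
have csN1 : -1 < cos s by rewrite -(@cospi R) cos_lt// ltW.
have -> : beta `](2 * cos s)%R, +oo[%classic = beta `](2 * cos s)%R, 2%R[%classic.
  rewrite (@arcsine_law_split _ `]2 * cos s, 2]); last first.
    apply/seteqP; split => y /=; rewrite !in_itv/= ?andbT.
      by move=> [-> /andP[_ ->]].
    by move=> /andP[sy y2]; split => //; apply/andP; split => //; lra.
  rewrite (@arcsine_law_split _ `]2 * cos s, 2[); last first.
    apply/seteqP; split => y /=; rewrite !in_itv/=; first by move=> [].
    by move=> /andP[sy y2]; split; apply/andP; split => //; lra.
  by rewrite integral_itv_bndo_bndc//; exact: measurable_arcsine_densityE.
(* Endpoints with angle s / (k + 2), so that their measures are explicit. *)
pose A k : set (measurableTypeR R) :=
  `](2 * cos s)%R, (2 * cos (s / k.+2%:R))%R]%classic.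
have sk k : 0 < s / k.+2%:R by rewrite divr_gt0// ltr0n.
have sks k : s / k.+2%:R <= s by rewrite ler_pdivrMr ?ltr0n// ler_peMr ?ler1n// ltW.
have AU : \bigcup_k A k = `](2 * cos s)%R, 2%R[%classic.
  apply/seteqP; split => [y [k _]|y]/=; rewrite /A/= !in_itv/= => /andP[sy yk].
    rewrite sy/=; apply: le_lt_trans yk _.
    rewrite -[ltRHS]mulr1 ltr_pM2l// -[ltRHS](@cos0 R); apply: cos_lt => //.
    by rewrite (le_trans (sks k))// ltW.
  have y2 : -2 <= y <= 2 by apply/andP; split; lra.
  have /andP[a0 api] := angle_itv y.
  have ay : 0 < angle y.
    rewrite lt_neqAle a0 andbT; apply/eqP => ay0.
    by move: yk; rewrite (cos_angleK y2) -ay0 cos0 mulr1 ltxx.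
  have [k ka] := harm_lt ay s0.
  exists k => //=; rewrite in_itv/= sy/= (cos_angleK y2) ler_pM2l//.
  by apply: cos_le; rewrite ?(ltW ka)// ltW.
have cv : beta (A k) @[k --> \oo] --> beta (\bigcup_k A k).
  have mA k : measurable (A k) by rewrite /A; exact: measurable_itv.
  apply: nondecreasing_cvg_mu => //; first exact: bigcupT_measurable.
  move=> m n mn; apply/subsetPset => y; rewrite /A/= !in_itv/= => /andP[-> /le_trans]; apply.
  rewrite ler_pM2l//; apply: cos_le; rewrite ?(ltW (sk _))//.
    by apply: harm_anti => //; exact: ltW.
  by rewrite (le_trans (sks m))// ltW.
rewrite -AU; apply: (cvg_unique _ cv) => //.
rewrite (_ : (fun k => _) = fun k => ((s - s / k.+2%:R) / pi)%:E); last first.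
  by apply/funext => k; rewrite arcsine_law_itv.
by apply: cvg_EFin; [exact: nearW|apply: cvgM; [exact: harm_cvg|exact: cvg_cst]].
Qed.

(** The same exhaustion at the endpoint -2. *)
Lemma arcsine_law_gtN2 : beta `](-2)%R, +oo[%classic = 1%E.
Proof.
pose s k : R := pi - pi / k.+2%:R.
pose A k : set (measurableTypeR R) := `](2 * cos (s k))%R, +oo[%classic.
have pk k : 0 < pi / k.+2%:R :> R by rewrite divr_gt0// ?ltr0n// pi_gt0.
have pk2 k : pi / k.+2%:R < pi :> R.
  by rewrite ltr_pdivrMr ?ltr0n// ltr_pMr ?pi_gt0// ltr1n.
have s_pi k : 0 < s k < pi by rewrite /s subr_gt0 pk2 gtrBl pk.
have AU : \bigcup_k A k = `](-2)%R, +oo[%classic.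
  apply/seteqP; split => [y [k _]|y]/=; rewrite /A/= !in_itv/= !andbT => sy.
    apply: lt_trans sy; have /andP[sk0 skpi] := s_pi k.
    by have := cos_lt (ltW sk0) skpi (lexx _); rewrite cospi; lra.
  have [y2|y2] := leP y 2; last first.
    exists 0%N => //=; rewrite in_itv/= andbT; apply: le_lt_trans y2.
    by have := cos_le1 (s 0%N); lra.
  have yy : -2 <= y <= 2 by rewrite (ltW sy).
  have /andP[a0 api] := angle_itv y.
  have ay : 0 < pi - angle y.
    rewrite subr_gt0 lt_neqAle api andbT; apply/eqP => ay0.
    by move: sy; rewrite (cos_angleK yy) ay0 cospi mulrN1 ltxx.
  have [k ka] := harm_lt ay (@pi_gt0 R).
  exists k => //=; rewrite in_itv/= andbT (cos_angleK yy) ltr_pM2l//.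
  have /andP[_ /ltW sk] := s_pi k.
  by apply: cos_lt => //; rewrite /s ltrBrDl -ltrBrDr.
have cv : beta (A k) @[k --> \oo] --> beta (\bigcup_k A k).
  have mA k : measurable (A k) by rewrite /A; exact: measurable_itv.
  apply: nondecreasing_cvg_mu => //; first exact: bigcupT_measurable.
  move=> m n mn; apply/subsetPset => y; rewrite /A/= !in_itv/= !andbT; apply: le_lt_trans.
  have /andP[/ltW s0 _] := s_pi m; have /andP[_ /ltW s1] := s_pi n.
  by rewrite ler_pM2l// cos_le// /s lerD2l lerN2 harm_anti// pi_ge0.
have pi0 : pi != 0 :> R by rewrite lt0r_neq0// pi_gt0.
rewrite -AU; apply: (cvg_unique _ cv) => //.
rewrite (_ : (fun k => _) = fun k => (s k / pi)%:E); last first.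
  by apply/funext => k; rewrite arcsine_law_ray.
rewrite -(divff pi0); apply: cvg_EFin; first exact: nearW.
by apply: cvgM; [exact: harm_cvg|exact: cvg_cst].
Qed.

End arcsine.

Section arcsine_is_law.
Context {R : realType}.
Notation beta := (@arcsine_law R).

Definition two_cos (t : measurableTypeR R) : measurableTypeR R := 2 * cos t.

Lemma measurable_two_cos : measurable_fun setT two_cos.
Proof. by apply: measurable_funM => //; exact: measurable_cos. Qed.

HB.instance Definition _ := isMeasurableFun.Build _ _ _ _ two_cos measurable_two_cos.

Lemma arcsine_lawT : beta setT = 1%E.
Proof.
rewrite -arcsine_law_gtN2 /arcsine_law setTI.
rewrite (_ : `](-2)%R, +oo[%classic `&` _ = `](-2)%R, 2%R]%classic); last first.
  apply/seteqP; split => y /=; rewrite !in_itv/= ?andbT.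
    by move=> [-> /andP[_ ->]].
  by move=> /andP[sy y2]; split => //; apply/andP; split => //; lra.
by rewrite integral_itv_obnd_cbnd//; exact: measurable_arcsine_densityE.
Qed.

Lemma angle_two_cos t : 0 <= t <= pi -> angle (two_cos t) = t.
Proof.
move=> t0; rewrite /angle clamp_id /two_cos.
  by rewrite mulrAC divff// mul1r cosK.
by have := cos_le1 t; have := cos_geN1 t; lra.
Qed.

Lemma arcsine_law_distribution (A : set (measurableTypeR R)) : measurable A ->
  beta A = distribution unif two_cos A.
Proof.
move=> mA.
refine (@measure_unique _ R (measurableTypeR R) (@RGenOInfty.G R)
  (fun k => `](- k%:R)%R, +oo[%classic) _ _ _ _
  beta (distribution unif two_cos) _ _ A mA).
- exact: RGenOInfty.measurableE.
- move=> _ _ [x ->] [y ->]; exists (Num.max x y).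
  apply/seteqP; split => z /=; rewrite !in_itv/= !andbT gt_max.
    by move=> [-> ->].
  by move=> /andP[-> ->].
- by move=> k; exists (- k%:R).
- rewrite -subTset => x _; exists (Num.truncn (- x)).+1 => //=.
  by rewrite in_itv/= andbT ltrNl truncnS_gt.
- move=> _ [x ->]; rewrite /distribution /pushforward/=.
  have [x2|x2] := leP 2 x.
    rewrite /arcsine_law (_ : _ `&` _ = set0) ?integral_set0; last first.
      by rewrite -subset0 => y /=; rewrite !in_itv/= andbT => -[xy /andP[_ y2]]; lra.
    rewrite [X in unif X](_ : _ = set0) ?measure0//.
    rewrite -subset0 => t /=; rewrite in_itv/= andbT /two_cos => xq.
    by have := cos_le1 t; lra.
  have [xm2|xm2] := ltP x (- 2).
    rewrite [X in unif X](_ : _ = setT); last first.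
      rewrite -subTset => t _ /=; rewrite in_itv/= andbT /two_cos.
      by have := cos_geN1 t; lra.
    rewrite [RHS]probability_setT -arcsine_lawT /arcsine_law setTI; congr integral.
    by rewrite setIidr// => y /=; rewrite !in_itv/= andbT; lra.
  have xx : -2 <= x <= 2 by rewrite xm2 ltW.
  have /andP[a0 api] := angle_itv x.
  have pi0 : pi != 0 :> R by rewrite lt0r_neq0// pi_gt0.
  have ax : 0 < angle x.
    rewrite lt_neqAle a0 andbT; apply/eqP => ax0.
    by move: x2; rewrite (cos_angleK xx) -ax0 cos0 mulr1 ltxx.
  have -> : beta `]x, +oo[%classic = (angle x / pi)%:E.
    move: api; rewrite le_eqVlt => /predU1P[ap|api].
      have xE : x = -2 by rewrite (cos_angleK xx) ap cospi mulrN1.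
      by rewrite ap xE arcsine_law_gtN2 divff.
    by rewrite [in LHS](cos_angleK xx) arcsine_law_ray// ax.
  have mq : measurable (two_cos @^-1` `]x, +oo[).
    by rewrite -[X in measurable X]setTI; exact: measurable_two_cos.
  rewrite (@unif_measure _ _ (fun t => 1 - (angle x <= t)%R%:R))//.
  + rewrite meanB; [|exact: bmeas_cst|exact: bmeas_le].
    rewrite mean_cst mean_unif_indic ?angle_itv//.
    by congr EFin; move: (angle x) (pi : R) pi0 => b p p0; field.
  + by apply: bmeasB; [exact: bmeas_cst|exact: bmeas_le].
  + move=> t t0.
    have -> : (t \in two_cos @^-1` `]x, +oo[%classic) = (t < angle x)%R.
      have -> : (t < angle x)%R = (x < two_cos t)%R.
        rewrite [in RHS](cos_angleK xx) /two_cos ltr_pM2l//.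
        by rewrite ltr_cos ?angle_in// in_itv.
      by apply/idP/idP; rewrite inE/= in_itv/= andbT.
    by rewrite ltNge; case: (angle x <= t)%R; rewrite ?subrr ?subr0.
- move=> k; apply: (@le_lt_trans _ _ (beta setT)); last by rewrite arcsine_lawT ltry.
  by apply: le_measure; rewrite ?inE.
Qed.

End arcsine_is_law.

(** * Densities proportional to x with respect to the arcsine law *)

Section equality_case.
Context {R : realType}.
Variables (mu nu : borel_probability R) (c : R).
Hypothesis Hc : forall A : set (measurableTypeR R), measurable A ->
  (mu A - nu A = \int[@arcsine_law R]_(x in A) (c * x)%:E)%E.

Let unif_point (s : R) : {ae unif, forall t, t != s}.
Proof.
exists [set s]; split; first exact: measurable_set1.
  by rewrite /unif /= /uniform_prob integral_set1.
by move=> t /= /negP; rewrite negbK => /eqP.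
Qed.

(** The integral of c * 2 cos s / pi over 0 <= s <= t. *)
Lemma cdf_gap_arcsine t : 0 <= t <= pi -> cdf_gap mu nu t = 2 * c / pi * sin t.
Proof.
move=> tpi.
pose A : set (measurableTypeR R) := [set x | (angle x <= t)%R].
have mA : measurable A.
  have := @measurable_fun_ler _ _ R setT (@angle R) (fun=> t) measurable_angle (measurable_cst _).
  by move=> /(_ measurableT [set true] I); rewrite setTI.
have indA (m : borel_probability R) : \int[m]_x (angle x <= t)%R%:R = fine (m A).
  rewrite -mean_indic//; apply: eq_Rintegral => x _; rewrite indicE.
  by have -> : (x \in A) = (angle x <= t)%R by apply/idP/idP; rewrite inE.
rewrite /cdf_gap /smean !indA -fineB ?fin_num_measure// Hc//.
pose g (s : measurableTypeR R) : R := 2 * c * cos s.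
have bcos : bmeas (cos : measurableTypeR R -> R) by apply: bmeas_cos.
have bg : bmeas g by exact: bmeasZ.
have bgi : bmeas (fun s : measurableTypeR R => g s - g s * (t <= s)%R%:R : R).
  by apply: bmeasB => //; apply: bmeasM => //; exact: bmeas_le.
have mf : measurable_fun setT (fun x : measurableTypeR R => (c * x)%:E).
  by apply/measurable_EFinP; exact: measurable_funM.
have ig : unif.-integrable (two_cos @^-1` A) (fun s => (c * two_cos s)%:E).
  apply: (integrableS measurableT) => //.
    by rewrite -[X in measurable X]setTI; exact: measurable_two_cos.
  rewrite (_ : (fun s => _) = EFin \o g); first exact: bmeas_integrable.
  by apply/funext => s; rewrite /g /two_cos /=; congr EFin; ring.
have mpre : measurable (two_cos @^-1` A : set (measurableTypeR R)).
  by rewrite -[X in measurable X]setTI; exact: measurable_two_cos.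
have H := integral_pushforward measurable_two_cos mf ig mA.
have -> : (\int[@arcsine_law R]_(x in A) (c * x)%:E =
    \int[unif]_s (g s - g s * (t <= s)%R%:R)%:E)%E.
  transitivity (\int[distribution unif two_cos]_(x in A) (c * x)%:E)%E.
    by apply: eq_measure_integral => B mB _; exact: arcsine_law_distribution.
  rewrite [LHS]H integral_mkcond; apply: ae_eq_integral => //.
  - apply/(measurable_restrictT _ _).1 => //.
    by have /integrableP[] := ig.
  - by apply/measurable_EFinP; case: bgi.
  (* [mean_unif] integrates over t <= s; the point s = t is negligible. *)
  apply: (@filterS2 _ _ (ae_filter_ringOfSetsType unif) _ _ _ _
    unif_support (unif_point t)) => s s0 st _.
  rewrite patchE.
  have -> : (s \in two_cos @^-1` A) = (s <= t)%R.
    by apply/idP/idP; rewrite inE /A/= angle_two_cos.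
  rewrite -(negbK (s <= t)%R) -ltNge le_eqVlt (negbTE _ : (t == s) = false)/=; last by rewrite eq_sym.
  case: (t < s)%R => /=; first by rewrite mulr1 subrr.
  by rewrite mulr0 subr0 /g /two_cos; congr EFin; ring.
rewrite -/(Rintegral unif setT (fun s => g s - g s * (t <= s)%R%:R)).
have cg : continuous g.
  by move=> s; apply: cvgM; [exact: cvg_cst|exact: continuous_cos].
have gM s : `|g s| <= `|2 * c| by rewrite /g normrM ler_piMr// cos_max.
have dG s : has_deriv (fun s => 2 * c * sin s) s (g s).
  by apply: derivZ; exact: is_derive_sin.
rewrite meanB//; last by apply: bmeasM => //; exact: bmeas_le.
rewrite (mean_unif0 cg gM dG) (mean_unif cg gM dG tpi) sinpi sin0.
by ring.
Qed.

(** Integration by parts, in the form of [mean_unif_sinn] and Fubini. *)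
Lemma moment_cdf_gap n :
  moment mu nu n = n%:R * pi * \int[unif]_t (sin (n%:R * t) * cdf_gap mu nu t).
Proof.
pose k (w : measurableTypeR R * measurableTypeR R) : R :=
  sin (n%:R * w.2) * (angle w.1 <= w.2)%R%:R.
have bsin := @bmeas_sin R n%:R.
have bi : bmeas (fun w : measurableTypeR R * measurableTypeR R => (angle w.1 <= w.2)%R%:R : R).
  by apply: bmeas_le => //; exact: measurable_angle1.
have bk : bmeas k by apply: bmeasM => //; exact: (bmeas_comp bsin measurable_snd).
have bt t := @bmeas_angle_le R t.
have M (m : borel_probability R) : \int[m]_x cos (n%:R * angle x) =
    cos (n%:R * pi) + n%:R * pi * \int[unif]_t (sin (n%:R * t) * \int[m]_x (angle x <= t)%R%:R).
  transitivity (\int[m]_x (cos (n%:R * pi) + n%:R * pi * \int[unif]_t k (x, t))).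
    apply: eq_Rintegral => x _; rewrite /k/= mean_unif_sinn ?angle_itv//.
    by rewrite addrC subrK.
  have b2 := bmeas_mean2 m unif bk.
  rewrite meanD; [|exact: bmeas_cst|exact: bmeasZ].
  rewrite mean_cst meanZ// (mean_swap m unif bk); congr (_ + _ * _).
  by apply: eq_Rintegral => t _; rewrite /k/= meanZ.
have bm (m : borel_probability R) :
    bmeas (fun t : measurableTypeR R => sin (n%:R * t) * \int[m]_x (angle x <= t)%R%:R : R).
  apply: bmeasM => //; exact: (bmeas_mean1 m unif bi).
rewrite /moment /smean !M opprD addrACA subrr add0r -mulrBr; congr (_ * _).
by rewrite -meanB//; apply: eq_Rintegral => t _; rewrite -mulrBr.
Qed.

Lemma moment_arcsine n : (2 <= n)%N -> moment mu nu n = 0.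
Proof.
move=> n2; rewrite moment_cdf_gap.
have bsn := @bmeas_sin R n%:R.
have bs := @bmeas_sin1 R.
have bss := bmeasM bsn bs.
have bl := bmeasM bsn (bmeas_cdf_gap mu nu).
have br := bmeasZ (2 * c / pi) bss.
transitivity (n%:R * pi * \int[unif]_t (2 * c / pi * (sin (n%:R * t) * sin t))).
  by congr (_ * _); apply: mean_unif_eq => // t tpi; rewrite cdf_gap_arcsine// mulrCA.
by rewrite meanZ// mean_unif_sinM// !mulr0.
Qed.

End equality_case.

(** * The inequality and its equality case *)

Lemma W1_sqr_le_entropy (R : realType) (mu nu : borel_probability R) :
  supported_m22 mu -> supported_m22 nu ->
  (W1 mu nu ^+ 2 <= 2%:E * free_entropy mu nu)%E.
Proof.
move=> smu snu.
have [[fmu fnu]|nf] := pselect (finite_log_energy mu /\ finite_log_energy nu); last first.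
  have two0 : (0 < 2%:E :> \bar R)%E by rewrite lte_fin.
  by rewrite /free_entropy asboolF// gt0_muley// leey.
have [h hE _] := free_entropy_limit smu snu fmu fnu.
rewrite hE; apply: (le_trans (W1_sqr_le_cdf_gap2 smu snu)).
by rewrite lee_fin ler_wpM2l// (entropy_ge_cdf_gap2 smu snu fmu fnu hE).
Qed.

(** When only the first moment survives, the entropy is 2 a_1 ^ 2 and the test
    function x already gives W_1 >= 2 |a_1|. *)
Lemma entropy_le_W1_sqr (R : realType) (mu nu : borel_probability R) :
  supported_m22 mu -> supported_m22 nu -> (free_entropy mu nu < +oo)%E ->
  (forall n, (2 <= n)%N -> moment mu nu n = 0) ->
  (2%:E * free_entropy mu nu <= W1 mu nu ^+ 2)%E.
Proof.
move=> smu snu + m0.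
have [[fmu fnu] _|nf] := pselect (finite_log_energy mu /\ finite_log_energy nu); last first.
  by rewrite /free_entropy asboolF// ltxx.
have [h hE _] := free_entropy_limit smu snu fmu fnu.
have hm := entropy_first_moment smu snu fmu fnu hE m0.
pose r := 2 * `|moment mu nu 1|.
have r0 : 0 <= r by rewrite mulr_ge0.
have -> : (2%:E * free_entropy mu nu = r%:E * r%:E)%E.
  rewrite hE hm -!EFinM; congr EFin.
  have mm : `|moment mu nu 1| * `|moment mu nu 1| = moment mu nu 1 ^+ 2.
    by rewrite -expr2 real_normK ?num_real.
  by rewrite /r mulrACA mm; ring.
by rewrite expe2; apply: lee_pmul; rewrite ?lee_fin//; exact: W1_ge_moment.
Qed.

Local Open Scope ereal_scope.

Theorem theorem1 (R : realType) :
  (forall mu nu : borel_probability R,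
    supported_m22 mu -> supported_m22 nu ->
    W1 mu nu ^+ 2 <= 2%:E * free_entropy mu nu) /\
  (forall (mu nu : borel_probability R) (c : R),
    supported_m22 mu -> supported_m22 nu ->
    (forall A : set (measurableTypeR R), measurable A ->
      mu A - nu A = \int[@arcsine_law R]_(x in A) (c * x)%:E) ->
    free_entropy mu nu < +oo ->
    W1 mu nu ^+ 2 = 2%:E * free_entropy mu nu).
Proof.
split=> [mu nu|mu nu c smu snu Hc fin]; first exact: W1_sqr_le_entropy.
apply/eqP; rewrite eq_le W1_sqr_le_entropy//= entropy_le_W1_sqr//.
exact: moment_arcsine Hc.
Qed.
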